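(* Let $K$ be a commutative ring and $\Lambda$ the ring of symmetric functions over $K$ in $x=(x_1,x_2,\dots)$. Then: (1) In $\widehat\Lambda$ we have $H(1)=\sum_{i\ge 0}h_i=\sum_{\lambda\in\mathcal{P}}G_\lambda$. (2) The ring homomorphism $i\colon\Lambda\to K$, $i(f)=f(1,0,0,\dots)$, satisfies (a) $i(f)=(H(1),f)$ for all $f\in\Lambda$, and (b) $i(g_{\lambda/\mu})=1$ for every skew shape $\lambda/\mu$. (3) The $K$-linear map $I\colon\Lambda\to\Lambda$ defined by $I(g_\lambda)=\sum_{\mu\subset\lambda}g_\mu$ is a ring automorphism, and $$I=H(1)^\perp=\sum_{\lambda\in\mathcal{P}}G_\lambda^\perp=\sum_{i\ge 0}h_i^\perp=\big(f(x_1,x_2,\dots)\mapsto f(1,x_1,x_2,\dots)\big).$$ Moreover for every skew shape $\lambda/\mu$, $$I(g_{\lambda/\mu})=\sum_{\mu\subset\nu\subset\lambda}g_{\nu/\mu}=\sum_{\mu\subset\nu\subset\lambda}g_{\lambda/\nu},$$ and in particular $I(g_\lambda)=\sum_{\nu\subset\lambda}g_\nu=\sum_{\nu\subset\lambda}g_{\lambda/\nu}$ for every partition $\lambda$.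
   Context: $K$ is a commutative ring. $\Lambda$ is the ring of symmetric formal power series of bounded degree in $x=(x_1,x_2,\dots)$ with coefficients in $K$; $\widehat\Lambda$ is its completion (all symmetric formal power series). $\mathcal{P}$ is the set of integer partitions, $s_\lambda$ the Schur functions, $h_i$ the complete homogeneous symmetric functions. The Hall inner product $(\,,)\colon\widehat\Lambda\times\Lambda\to K$ is defined by $(\sum_\lambda a_\lambda s_\lambda,\sum_\lambda b_\lambda s_\lambda)=\sum_\lambda a_\lambda b_\lambda$. The coproduct $\Delta\colon\Lambda\to\Lambda\otimes\Lambda$ is $f(x)\mapsto f(x,y)\in\Lambda(x)\otimes\Lambda(y)$. For $F\in\widehat\Lambda$, $F^\perp\colon\Lambda\to\Lambda$ is $F^\perp(f)=\sum(F,f_1)f_2$ where $\Delta(f)=\sum f_1\otimes f_2$ (equivalently the adjoint of multiplication by $F$: $(FG,f)=(G,F^\perp f)$). A skew shape $\lambda/\mu$ is a pair of partitions $\mu\subset\lambda$ (Young diagram containment). A reverse plane partition of shape $\lambda/\mu$ is a filling of the boxes of $\lambda/\mu$ by positive integers weakly increasing along every row and every column. The dual stable Grothendieck polynomial is $g_{\lambda/\mu}=\sum_T x^T$, summed over reverse plane partitions $T$ of shape $\lambda/\mu$, where $x^T=\prod_i x_i^{T(i)}$ and $T(i)$ is the number of columns of $T$ containing the entry $i$; $g_\lambda=g_{\lambda/\emptyset}$. It is known that $g_{\lambda/\mu}\in\Lambda$ and $\{g_\lambda\}_{\lambda\in\mathcal{P}}$ is a $K$-basis of $\Lambda$. The stable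 Grothendieck polynomials $G_\lambda\in\widehat\Lambda$ are the dual family: $(G_\lambda,g_\mu)=\delta_{\lambda\mu}$, and every element of $\widehat\Lambda$ is uniquely an (possibly infinite) linear combination of the $G_\lambda$. *)

(* Defs.v *)
From HB Require Import structures.
From mathcomp Require Import all_boot all_order all_algebra finmap.
From mathcomp Require Import boolp classical_sets functions cardinality fsbigop.
From mathcomp.multinomials Require Import monalg.

Set Implicit Arguments.
Unset Strict Implicit.
Unset Printing Implicit Defensive.

Import GRing.Theory.

Local Open Scope classical_set_scope.
Local Open Scope ring_scope.

(* Conventions.
   - The alphabet x = (x_1, x_2, ...) is indexed from 0: the index i : nat stands
     for the variable x_(i+1), and an entry i of a tableau for the positive
     integer i+1.  [m i] is the exponent of the variable of index i in m.
   - [\sum_(i \in A) F i] (fsbigop) is the sum of the finitely many nonzero F i;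
     it is 0 when infinitely many of them are nonzero. *)
Notation monom := {cmonom nat}.

Record series (K : Type) := Series { coef :> monom -> K }.

HB.instance Definition _ (K : Type) := [isNew for @coef K].
HB.instance Definition _ (K : choiceType) := [Choice of series K by <:].

Lemma seriesP (K : Type) (f g : series K) : f =1 g -> f = g.
Proof. by case: f => f; case: g => g /= /funext ->. Qed.

Section SeriesLmodule.
Variable K : pzRingType.
Implicit Types f g : series K.

Definition sadd f g := Series (fun m => f m + g m).
Definition sopp f := Series (fun m => - f m).
Definition szero : series K := Series (fun=> 0).
Definition sscale (a : K) f := Series (fun m => a * f m).

Fact saddA : associative sadd.
Proof. by move=> f g h; apply: seriesP => m; apply: addrA. Qed.
Fact saddC : commutative sadd.
Proof. by move=> f g; apply: seriesP => m; apply: addrC. Qed.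
Fact sadd0 : left_id szero sadd.
Proof. by move=> f; apply: seriesP => m; apply: add0r. Qed.
Fact saddN : left_inverse szero sopp sadd.
Proof. by move=> f; apply: seriesP => m; apply: addNr. Qed.
HB.instance Definition _ :=
  GRing.isZmodule.Build (series K) saddA saddC sadd0 saddN.

Fact sscaleA a b f : sscale a (sscale b f) = sscale (a * b) f.
Proof. by apply: seriesP => m; apply: mulrA. Qed.
Fact sscale1 : left_id 1 sscale.
Proof. by move=> f; apply: seriesP => m; apply: mul1r. Qed.
Fact sscaleDr : right_distributive sscale +%R.
Proof. by move=> a f g; apply: seriesP => m; apply: mulrDr. Qed.
Fact sscaleDl f : {morph sscale^~ f : a b / a + b}.
Proof. by move=> a b; apply: seriesP => m; apply: mulrDl. Qed.
HB.instance Definition _ := GRing.Zmodule_isLmodule.Build K (series K)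
  sscaleA sscale1 sscaleDr sscaleDl.

End SeriesLmodule.

Fact fsbig_filter (R : pzRingType) (T : choiceType) (r : seq T) (P : set T)
    (F : T -> R) : uniq r -> P `<=` [set` r] ->
  \sum_(i \in P) F i = \sum_(i <- r | i \in P) F i.
Proof.
move=> ur Pr; rewrite (fsbig_fwiden [seq i <- r | i \in P]); first last.
- by move=> i [] /=; rewrite mem_filter => /andP[/set_mem].
- exact: filter_uniq.
- by move=> i Pi /=; rewrite mem_filter mem_set //= Pr.
by rewrite big_filter.
Qed.

Fact divisors_finite (m : monom) : exists2 s : seq monom,
  uniq s & forall a b, mmul a b = m -> a \in s.
Proof.
pose n := mdeg m.
pose F (u : {ffun finsupp m -> 'I_n.+1}) : monom :=
  mkcmonom [fsfun i : finsupp m => nat_of_ord (u i) | 0%N].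
exists (undup (codom F)); first exact: undup_uniq.
move=> a b abm; rewrite mem_undup; apply/codomP.
have le_am i : (a i <= m i)%N by rewrite -abm cmM leq_addr.
have le_an i : (a i <= n)%N.
  case: (mdomP m i) (le_am i) => [im|_]; last by rewrite leqn0 => /eqP ->.
  by move=> /leq_trans; apply; rewrite /n mdegE (big_fsetD1 i im) /= leq_addr.
exists [ffun i => inord (a (fsval i))]; apply/eqP/cmP => i; rewrite cmE.
case: (finsuppP m i) (le_am i) => [im|im _].
  by rewrite leqn0 fsfun_ffun insubF ?(negbTE im) // => /eqP.
by rewrite fsfun_ffun insubT /= ffunE inordK // ltnS.
Qed.

Section SeriesRing.
Variable K : comPzRingType.
Implicit Types f g h : series K.

Definition smul f g : series K :=
  Series (fun m => \sum_(p \in [set p : monom * monom | mmul p.1 p.2 = m])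
                     f p.1 * g p.2).
Definition sone : series K := Series (fun m => (m == mone)%:R).

Fact smulE (s : seq monom) f g m : uniq s ->
    (forall a b, mmul a b = m -> a \in s) ->
  smul f g m =
  \sum_(a <- s) \sum_(b <- s) if mmul a b == m then f a * g b else 0.
Proof.
move=> us sP; rewrite /smul /= (@fsbig_filter _ _ [seq (a, b) | a <- s, b <- s]).
- rewrite big_mkcond big_allpairs /=; apply: eq_bigr => a _.
  by apply: eq_bigr => b _; congr (if _ then _ else _); apply/idP/eqP; rewrite inE.
- by apply: allpairs_uniq => // -[? ?] [? ?].
- move=> [a b] /= abm; apply/allpairsP; exists (a, b); split=> //=.
    exact: sP abm.
  by apply: (sP b a); rewrite mulmC.
Qed.

Fact smulC : commutative smul.
Proof.
move=> f g; apply: seriesP => m; have [s us sP] := divisors_finite m.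
rewrite !(smulE _ _ us sP) exchange_big; apply: eq_bigr => a _.
by apply: eq_bigr => b _; rewrite mulmC mulrC.
Qed.

Fact divisors_trans (s : seq monom) m : (forall a b, mmul a b = m -> a \in s) ->
  forall a b, mmul a b = m -> forall c d, mmul c d = a -> c \in s.
Proof.
by move=> sP a b abm c d cda; apply: (sP c (mmul d b)); rewrite mulmA cda.
Qed.

Fact big_pick1 (s : seq monom) (a : monom) (F : monom -> K) : uniq s ->
  \sum_(c <- s) (if a == c then F c else 0) = if a \in s then F a else 0.
Proof.
move=> us; case: ifPn => [as_|as_].
  rewrite (bigD1_seq a) //= eqxx big1 ?addr0 // => c ca.
  by rewrite eq_sym (negbTE ca).
rewrite big_seq big1 // => c cs; case: eqP => // ac.
by rewrite ac cs in as_.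
Qed.

Fact smulmE (s : seq monom) f g h m : uniq s ->
    (forall a b, mmul a b = m -> a \in s) ->
  smul (smul f g) h m = \sum_(a <- s) \sum_(b <- s) \sum_(c <- s)
    if mmul (mmul a b) c == m then f a * g b * h c else 0.
Proof.
move=> us sP; rewrite (smulE _ _ us sP).
have E d c : (if mmul d c == m then smul f g d * h c else 0) =
  \sum_(a <- s) \sum_(b <- s)
    if mmul a b == d then if mmul d c == m then f a * g b * h c else 0 else 0.
  case: eqP => [dcm|_]; last by rewrite big1 // => a _; rewrite big1 // => b _; case: ifP.
  rewrite (smulE _ _ us (divisors_trans sP dcm)) mulr_suml; apply: eq_bigr => a _.
  by rewrite mulr_suml; apply: eq_bigr => b _; case: ifP; rewrite ?mul0r.
under eq_bigr do under eq_bigr do rewrite E.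
rewrite exchange_big /=; under eq_bigr do rewrite exchange_big /=.
under eq_bigr do under eq_bigr do rewrite exchange_big /=.
under eq_bigr do under eq_bigr do under eq_bigr do rewrite big_pick1 //.
rewrite exchange_big /=; apply: eq_bigr => a _.
rewrite exchange_big /=; apply: eq_bigr => b _; apply: eq_bigr => c _.
by case: ifPn => // abs; case: eqP => // /sP; rewrite (negbTE abs).
Qed.

Fact smulA : associative smul.
Proof.
move=> f g h; apply: seriesP => m; have [s us sP] := divisors_finite m.
rewrite smulC !(smulmE _ _ _ us sP) [RHS]exchange_big /=.
under [RHS]eq_bigr do rewrite exchange_big /=.
apply: eq_bigr => b _; apply: eq_bigr => c _; apply: eq_bigr => a _.
by rewrite -[mmul (mmul a b) c]mulmA [mmul a _]mulmC -[f a * _ * _]mulrA [f a * _]mulrC.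
Qed.

Fact smul1 : left_id sone smul.
Proof.
move=> f; apply: seriesP => m; have [s us sP] := divisors_finite m.
rewrite (smulE _ _ us sP) exchange_big /=.
transitivity (\sum_(b <- s) if m == b then f b else 0); last first.
  by rewrite big_pick1 // (sP m mone) ?mulm1.
apply: eq_bigr => b _.
transitivity (\sum_(a <- s) if mone == a
    then if mmul a b == m then f b else 0 else 0).
  apply: eq_bigr => a _; rewrite /= [mone == a]eq_sym.
  by case: (a == mone); rewrite ?mul1r ?mul0r //; case: ifP.
by rewrite big_pick1 // (sP mone m) ?mul1m // eq_sym.
Qed.

Fact smulDl : left_distributive smul +%R.
Proof.
move=> f g h; apply: seriesP => m; have [s us sP] := divisors_finite m.
change (smul (f + g) h m = smul f h m + smul g h m).
rewrite !(smulE _ _ us sP) -big_split; apply: eq_bigr => a _.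
rewrite -big_split; apply: eq_bigr => b _ /=.
by case: ifP; rewrite ?addr0 //= mulrDl.
Qed.

HB.instance Definition _ :=
  GRing.Zmodule_isComPzRing.Build (series K) smulA smulC smul1 smulDl.

End SeriesRing.

Definition sym_series (K : Type) (f : series K) : Prop :=
  forall (s : nat -> nat) (m m' : monom),
    bijective s -> (forall i, m' i = m (s i)) -> f m' = f m.

Definition bounded_degree (K : nmodType) (f : series K) : Prop :=
  exists d : nat, forall m : monom, (d < mdeg m)%N -> f m = 0.

Fact permmon_exists (s : nat -> nat) : bijective s ->
  exists2 F : monom -> monom, bijective F & forall m i, F m i = m (s i).
Proof.
have ex t u : cancel t u -> exists F : monom -> monom, forall m i, F m i = m (t i).
  move=> tK.
  exists (fun m : monom => [cmonom m (t i) | i in [fset u j | j in finsupp m]]%M).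
  move=> m i; rewrite cmE fsfun_fun; case: ifPn => // /negP nF; apply/esym/eqP.
  rewrite cmE_eq0; apply/negP => ti; apply: nF; apply/imfsetP.
  by exists (t i); rewrite ?tK.
move=> [t sK tK]; have [F FE] := ex _ _ sK; have [G GE] := ex _ _ tK.
by exists F => //; exists G => m; apply/eqP/cmP => i; rewrite ?FE ?GE ?FE ?sK ?tK.
Qed.

Fact permmon_mdeg (s : nat -> nat) (m m' : monom) :
  bijective s -> (forall i, m' i = m (s i)) -> mdeg m' = mdeg m.
Proof.
move=> bs mE; have [t sK tK] := bs.
have E : finsupp m = (s @` finsupp m')%fset.
  apply/fsetP => i; apply/idP/imfsetP => [im|[j jm' ->]]; last first.
    by rewrite -cmE_neq0 -mE cmE_neq0.
  by exists (t i); rewrite ?tK //= -cmE_neq0 mE tK cmE_neq0.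
rewrite !mdegE E big_imfset /=; last by move=> i j _ _; apply: (can_inj sK).
by apply: eq_bigr => i _; rewrite mE.
Qed.

Section SymmetricFunctions.
Variable K : comPzRingType.

Definition is_sym : pred (series K) := fun f => `[< sym_series f >].

Fact is_sym_subring : subring_closed is_sym.
Proof.
split.
- apply/asboolP => s m m' bs mE /=; congr (nat_of_bool _)%:R.
  have [t sK tK] := bs.
  apply/eqP/eqP => E; apply/eqP/cmP => i; last by rewrite mE E !cm1.
  by rewrite -[i]tK -mE E !cm1.
- move=> f g /asboolP fs /asboolP gs; apply/asboolP => s m m' bs mE.
  by congr (_ - _); [apply: fs mE | apply: gs mE].
- move=> f g /asboolP fs /asboolP gs; apply/asboolP => s m m' bs mE.
  have [F bF FE] := permmon_exists bs; have injF := bij_inj bF.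
  rewrite /= (reindex_fsbig (fun p => (F p.1, F p.2))
                [set p | mmul p.1 p.2 = m]).
    by apply: eq_fsbigr => p _; congr (_ * _); [exact: fs bs (FE _)|exact: gs bs (FE _)].
  have FM a b : F (mmul a b) = mmul (F a) (F b).
    by apply/eqP/cmP => i; rewrite !(FE, cmM).
  have -> : m' = F m by apply/eqP/cmP => i; rewrite FE.
  have [G FK GK] := bF.
  split=> [p /= <-//|[a b] [c d] _ _ [/injF -> /injF ->] //|[a b] /= abm].
  by exists (G a, G b); rewrite /= ?GK //; apply: injF; rewrite FM !GK.
Qed.
HB.instance Definition _ := GRing.isSubringClosed.Build (series K) is_sym
  is_sym_subring.

Fact is_sym_scale : GRing.scaler_closed is_sym.
Proof.
move=> a f /asboolP fs; apply/asboolP => s m m' bs mE.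
by congr (a * _); apply: fs mE.
Qed.
HB.instance Definition _ := GRing.isScaleClosed.Build K (series K) is_sym
  is_sym_scale.

Record LambdaHat := MkLambdaHat {
  hat_series :> series K;
  hat_seriesP : hat_series \in is_sym }.

HB.instance Definition _ := [isSub of LambdaHat for hat_series].
HB.instance Definition _ := [Choice of LambdaHat by <:].
HB.instance Definition _ :=
  GRing.SubChoice_isSubComPzRing.Build (series K) is_sym LambdaHat is_sym_subring.
HB.instance Definition _ := [SubZmodule_isSubLmodule of LambdaHat by <:].

Definition is_bounded : pred LambdaHat := fun f => `[< bounded_degree f >].

Fact is_bounded_subring : subring_closed is_bounded.
Proof.
split.
- by apply/asboolP; exists 0%N => m /=; rewrite lt0n mdeg_eq0 => /negPf ->.
- move=> f g /asboolP[d fd] /asboolP[e ge]; apply/asboolP; exists (d + e)%N.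
  move=> m dem; rewrite /= fd ?ge ?subrr //; apply: leq_ltn_trans dem.
    exact: leq_addl.
  exact: leq_addr.
- move=> f g /asboolP[d fd] /asboolP[e ge]; apply/asboolP; exists (d + e)%N.
  move=> m dem /=; apply: fsbig1 => -[a b] /= abm.
  have [ad|da] := leqP (mdeg a) d; last by rewrite fd ?mul0r.
  rewrite ge ?mulr0 //; move: dem; rewrite -abm mdegM ltnNge => dem.
  by rewrite ltnNge; apply: contra dem => be; apply: leq_add.
Qed.
HB.instance Definition _ := GRing.isSubringClosed.Build LambdaHat is_bounded
  is_bounded_subring.

Fact is_bounded_scale : GRing.scaler_closed is_bounded.
Proof.
move=> a f /asboolP[d fd]; apply/asboolP; exists d => m dm.
by rewrite /= fd ?mulr0.
Qed.
HB.instance Definition _ := GRing.isScaleClosed.Build K LambdaHat is_bounded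
  is_bounded_scale.

Record Lambda := MkLambda {
  lambda_hat :> LambdaHat;
  lambda_hatP : lambda_hat \in is_bounded }.

HB.instance Definition _ := [isSub of Lambda for lambda_hat].
HB.instance Definition _ := [Choice of Lambda by <:].
HB.instance Definition _ :=
  GRing.SubChoice_isSubComPzRing.Build LambdaHat is_bounded Lambda is_bounded_subring.
HB.instance Definition _ := [SubZmodule_isSubLmodule of Lambda by <:].

(* Infinite sums in LambdaHat are taken coefficientwise; [summable F] is the
   condition under which [hatsum F] is meaningful. *)
Definition summable (I : choiceType) (F : I -> LambdaHat) : Prop :=
  forall m : monom, finite_set [set i | F i m != 0].

Fact hatsum_subproof (I : choiceType) (F : I -> LambdaHat) :
  Series (fun m => \sum_(i \in [set: I]) F i m) \in is_sym.
Proof.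
apply/asboolP => s m m' bs mE; apply: eq_fsbigr => i _.
by have /asboolP := hat_seriesP (F i); apply; first exact: bs.
Qed.
Definition hatsum (I : choiceType) (F : I -> LambdaHat) : LambdaHat :=
  MkLambdaHat (hatsum_subproof F).

(* h_i is the sum of all monomials of degree i. *)
Fact hsym_hat_subproof (i : nat) :
  Series (fun m : monom => (mdeg m == i)%:R) \in is_sym.
Proof.
by apply/asboolP => s m m' bs mE /=; rewrite (permmon_mdeg bs mE).
Qed.
Definition hsym_hat (i : nat) : LambdaHat := MkLambdaHat (hsym_hat_subproof i).
Fact hsym_hat_bounded (i : nat) : hsym_hat i \in is_bounded.
Proof. by apply/asboolP; exists i => m im /=; rewrite gtn_eqF. Qed.
Definition hsym (i : nat) : Lambda := MkLambda (hsym_hat_bounded i).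

Definition Hgen (t : K) : LambdaHat :=
  hatsum (fun i : nat => t ^+ i *: (hsym i : LambdaHat)).

End SymmetricFunctions.

Definition is_intpart (s : seq nat) : bool := sorted geq s && (0 \notin s)%N.

Record intpart := IntPart { parts :> seq nat; _ : is_intpart parts }.
HB.instance Definition _ := [isSub of intpart for parts].
HB.instance Definition _ := [Countable of intpart by <:].

Definition emptyp : intpart := IntPart (isT : is_intpart [::]).

(* The length of row i (rows and columns are numbered from 0). *)
Definition row_len (la : intpart) (i : nat) : nat := nth 0%N la i.

Definition part_sub (mu la : intpart) : Prop :=
  forall i, (row_len mu i <= row_len la i)%N.

(* A box is a pair (row, column). *)
Definition box (la mu : intpart) : Type :=
  {c : 'I_(size la) * 'I_(row_len la 0) |
    (row_len mu c.1 <= c.2 < row_len la c.1)%N}.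

Section Tableaux.
Variables la mu : intpart.

Definition brow (c : box la mu) : 'I_(size la) := (val c).1.
Definition bcol (c : box la mu) : 'I_(row_len la 0) := (val c).2.

Definition filling := {ffun box la mu -> nat}.

Definition is_rpp (T : filling) : Prop :=
  (forall c d, brow c = brow d -> (bcol c <= bcol d)%N -> (T c <= T d)%N) /\
  (forall c d, bcol c = bcol d -> (brow c <= brow d)%N -> (T c <= T d)%N).

Definition is_ssyt (T : filling) : Prop :=
  (forall c d, brow c = brow d -> (bcol c <= bcol d)%N -> (T c <= T d)%N) /\
  (forall c d, bcol c = bcol d -> (brow c < brow d)%N -> (T c < T d)%N).

Definition ncols (T : filling) (i : nat) : nat :=
  #|[set j | [exists c, (bcol c == j) && (T c == i)]]%SET|.

Definition nboxes (T : filling) (i : nat) : nat :=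
  #|[set c | T c == i]%SET|.

End Tableaux.

Section Functions.
Variable K : comPzRingType.

(* The coefficient of m in sum_T x^T is the number of T with x^T = m. *)
Definition g_series (la mu : intpart) : series K :=
  Series (fun m => \sum_(T \in [set T : filling la mu |
                       is_rpp T /\ forall i, m i = ncols T i]) (1 : K)).

(* [g_series la mu] is symmetric of bounded degree, so that [gskew la mu] is that
   series, seen in Lambda; the default values of [insubd] are never used. *)
Definition gskew (la mu : intpart) : Lambda K :=
  insubd 0 (insubd 0 (g_series la mu)).

Definition gdual (la : intpart) : Lambda K := gskew la emptyp.

Definition schur (la : intpart) : series K :=
  Series (fun m => \sum_(T \in [set T : filling la emptyp |
                       is_ssyt T /\ forall i, m i = nboxes T i]) (1 : K)).

(* The family (a_la) such that F = sum_la a_la s_la. *)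
Definition schur_coef (F : LambdaHat K) : intpart -> K :=
  xget (fun=> 0) [set a : intpart -> K |
    forall m, F m = \sum_(la \in [set: intpart]) a la * schur la m].

Definition hall (F : LambdaHat K) (f : Lambda K) : K :=
  \sum_(la \in [set: intpart]) schur_coef F la * schur_coef f la.

(* G_la is the element of LambdaHat dual to g_la. *)
Definition Groth (la : intpart) : LambdaHat K :=
  xget 0 [set F | forall mu, hall F (gdual mu) = (la == mu)%:R].

(* [t] is a decomposition sum f_1 (x) f_2 of the coproduct f(x,y) of f: the
   alphabet x is put on the even indices and y on the odd ones, so that the
   coefficient of x^a y^b in f(x,y) is that in f of the monomial m whose even
   part is a and whose odd part is b. *)
Definition is_coproduct (f : Lambda K) (t : seq (Lambda K * Lambda K)) : Prop :=
  forall a b m : monom,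
    (forall i, m i.*2 = a i) -> (forall i, m i.*2.+1 = b i) ->
    f m = \sum_(p <- t) p.1 a * p.2 b.

Definition coproduct (f : Lambda K) : seq (Lambda K * Lambda K) :=
  xget [::] [set t | is_coproduct f t].

Definition perp (F : LambdaHat K) (f : Lambda K) : Lambda K :=
  \sum_(p <- coproduct f) hall F p.1 *: p.2.

(* Pointwise sum of a family of operators on Lambda: for each f only finitely
   many terms are nonzero, and they add up to I f. *)
Definition is_opsum (J : choiceType) (A : J -> Lambda K -> Lambda K)
    (I : Lambda K -> Lambda K) : Prop :=
  forall f, finite_set [set j | A j f != 0] /\ I f = \sum_(j \in [set: J]) A j f.

(* f(1, 0, 0, ...): only the powers of x_1 contribute. *)
Definition eval_1 (f : Lambda K) : K :=
  \sum_(n \in [set n : monom | forall i, n i.+1 = 0%N]) f n.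

(* f(1, x_1, x_2, ...): the coefficient of m is the sum of the coefficients in f
   of the monomials which become m under x_1 |-> 1, x_(i+1) |-> x_i. *)
Definition subst_1x (f : Lambda K) : series K :=
  Series (fun m => \sum_(n \in [set n : monom | forall i, n i.+1 = m i]) f n).

End Functions.

Arguments gskew K la mu : clear implicits.
Arguments gdual K la : clear implicits.
Arguments Groth K la : clear implicits.
Arguments hsym K i : clear implicits.

(* Main.v *)
(* A reverse plane partition of shape la/mu with column content (m_0, ..., m_(N-1))
   is a chain mu = nu_0 <= nu_1 <= ... <= nu_N = la of partitions in which
   nu_(i+1)/nu_i has m_i nonempty columns. Removing the first or the last letter
   removes the first or the last link of the chain, so once g_(la/mu) is known to be
   symmetric, setting one variable to 1 gives both formulas for I(g_(la/mu)).
   Symmetry is the symmetry in a and b of the two-letter sum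
   sum_nu a^(columns of nu/mu) b^(columns of la/nu), proved by induction on the columns.
   The Schur function s_la is the top degree part of g_la, and by the dominance order
   both families are unitriangular with respect to the monomials x^mu, so they are
   bases. The coefficient of y^b in f(x, y) is a symmetric function of x, its "slice";
   F^perp f is obtained by pairing F with the slices of f, and (H(1), f) = f(1, 0, ...)
   turns H(1)^perp into f(1, x_1, x_2, ...). This substitution is a ring morphism equal
   to the identity up to lower degree terms, hence bijective. *)
Require Import Defs.
From HB Require Import structures.
From mathcomp Require Import all_boot all_order all_algebra finmap.
From mathcomp Require Import boolp classical_sets functions cardinality fsbigop.
From mathcomp.multinomials Require Import monalg.
From mathcomp Require Import zify ring.

Set Implicit Arguments.
Unset Strict Implicit.
Unset Printing Implicit Defensive.

Import GRing.Theory.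

Local Open Scope classical_set_scope.
Local Open Scope ring_scope.

(** * Partitions and the lists of partitions between two of them *)

(** Chains are counted in nat and only then mapped to [K]: a positive count may vanish in [K], so
    triangularity rests on the existence of chains, and the two-letter symmetry is proved for
    independent variables over int and transferred by comparing coefficients.

    The obstacle in the induction on the columns is that heights must decrease weakly: the sum over
    the columns further right depends on the height chosen for the current one, and once this height
    acts as a real constraint the sum need not be symmetric. What stays symmetric is a combination
    of such capped sums at two heights, and the induction has to carry it along.

    The families and decompositions obtained by choice are used only through properties that
    determine the result: [G_la] reads off a coordinate in the basis [g], and the adjoint operators
    do not depend on the decomposition of the coproduct that was picked. *)

Section Shapes.
Local Open Scope nat_scope.

(** On a downward closed predicate the counted indices form an initial segment, so a count is a
    threshold. This turns row lengths and column heights into membership of single boxes. *)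
Lemma count_downset (P : pred nat) n i : (forall i j, i <= j -> P j -> P i) ->
  (i < count P (iota 0 n)) = (i < n) && P i.
Proof.
move=> Pd; elim: n => [|n IHn]; first by rewrite ltn0.
rewrite -[in count _ _]addn1 iotaD count_cat /= addn0.
have [Pn|nPn] := boolP (P n).
  have -> : count P (iota 0 n) = n.
    rewrite -{2}(size_iota 0 n); apply/eqP; rewrite -all_count; apply/allP => j.
    by rewrite mem_iota => /andP[_ jn]; apply: Pd Pn; apply: ltnW.
  by rewrite addn1; case: ltnP => //= ile; rewrite (Pd i n).
rewrite /= addn0 IHn ltnS [in RHS]leq_eqVlt.
by case: eqVneq => [->|//]; rewrite ltnn (negbTE nPn).
Qed.

Lemma eq_ltn m n : (forall i, (i < m) = (i < n)) -> m = n.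
Proof.
move=> E; apply/eqP.
by rewrite eqn_leq leqNgt E ltnn leqNgt -E ltnn.
Qed.

Lemma row_len_leq (la : intpart) i j : i <= j -> row_len la j <= row_len la i.
Proof.
move=> ij; have [jn|nj] := ltnP j (size la); last by rewrite /row_len nth_default.
have /andP[sla _] := valP la.
have /(_ i j) := sorted_leq_nth (rev_trans leq_trans) leqnn 0 sla.
by rewrite !inE => -> //; apply: leq_ltn_trans jn.
Qed.

Lemma row_len_gt0 (la : intpart) i : (0 < row_len la i) = (i < size la).
Proof.
have [il|li] := ltnP i (size la); last by rewrite /row_len nth_default.
rewrite lt0n; apply: contraTneq (mem_nth 0 il) => row0.
by move: row0; rewrite /row_len => ->; case/andP: (valP la).
Qed.

Lemma intpart_ext (la mu : intpart) : row_len la =1 row_len mu -> la = mu.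
Proof.
move=> E; apply: val_inj; have sz : size la = size mu.
  by apply: eq_ltn => i; rewrite -!row_len_gt0 E.
apply: (@eq_from_nth _ 0) => // i _; apply: E.
Qed.

(* Reads the i-th row off any list of column heights: it does not matter
   whether the list is sorted. *)
Fact of_cols_subproof (h : seq nat) :
  is_intpart [seq count (fun c => i < c) h | i <- iota 0 (foldr maxn 0 h)].
Proof.
apply/andP; split.
  apply: (homo_sorted (e := ltn)); last exact: iota_ltn_sorted.
  move=> i j ij /=; apply: sub_count => c /=; exact/ltn_trans.
apply/mapP => -[i]; rewrite mem_iota => /andP[_ ilt] /esym/eqP.
rewrite eqn0Ngt -has_count => /hasPn hi.
suff : foldr maxn 0 h <= i by rewrite leqNgt ilt.
elim: h hi {ilt} => //= c h IHh hi; rewrite geq_max leqNgt hi ?mem_head //=.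
by apply: IHh => x xh; rewrite hi // inE xh orbT.
Qed.
Definition of_cols h : intpart := IntPart (of_cols_subproof h).

Lemma row_len_of_cols h i : row_len (of_cols h) i = count (fun c => i < c) h.
Proof.
rewrite /row_len /=; have [il|li] := ltnP i (foldr maxn 0 h).
  by rewrite (nth_map 0) ?size_iota // nth_iota.
rewrite nth_default ?size_map ?size_iota //; apply/esym/eqP.
rewrite eqn0Ngt -has_count; apply/hasPn => c.
elim: h li => //= x h IHh; rewrite geq_max inE => /andP[xi hi] /orP[/eqP ->|/IHh->//].
by rewrite -leqNgt.
Qed.

Lemma count_sorted h i j : sorted geq h ->
  (j < count (fun c => i < c) h) = (i < nth 0 h j).
Proof.
move=> sh; rewrite -{1}[h](mkseq_nth 0) count_map count_downset /=; last first.
  move=> k l kl il; have [lh|hl] := ltnP l (size h); last by rewrite nth_default in il.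
  apply: leq_trans il _.
  have /(_ k l) := sorted_leq_nth (rev_trans leq_trans) leqnn 0 sh.
  by rewrite !inE => -> //; apply: leq_ltn_trans lh.
by have [//|hj] := ltnP j (size h); rewrite nth_default.
Qed.

Definition conjp (la : intpart) : intpart := of_cols la.

Lemma ltn_conjp (la : intpart) i j : (i < row_len (conjp la) j) = (j < row_len la i).
Proof. by rewrite row_len_of_cols count_sorted //; case/andP: (valP la). Qed.

Lemma row_conjp_of_cols h j : sorted geq h ->
  row_len (conjp (of_cols h)) j = nth 0 h j.
Proof.
move=> sh; apply: eq_ltn => i.
by rewrite ltn_conjp row_len_of_cols count_sorted.
Qed.

Definition psub (mu la : intpart) :=
  all (fun i => row_len mu i <= row_len la i) (iota 0 (size mu)).

Lemma psubP mu la : reflect (part_sub mu la) (psub mu la).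
Proof.
apply: (iffP allP) => [H i|H i _]; last exact: H.
have [il|li] := ltnP i (size mu); first by apply: H; rewrite mem_iota.
by rewrite {1}/row_len nth_default.
Qed.

Lemma part_sub_ltn mu la : part_sub mu la <->
  (forall i j, j < row_len mu i -> j < row_len la i).
Proof.
split=> [H i j /leq_trans|H i]; first exact.
by rewrite leqNgt; apply/negP => /H; rewrite ltnn.
Qed.

Lemma psub_conj mu la : psub (conjp mu) (conjp la) = psub mu la.
Proof.
apply/psubP/psubP => /part_sub_ltn H; apply/part_sub_ltn => i j.
  by rewrite -ltn_conjp => /H; rewrite ltn_conjp.
by rewrite ltn_conjp => /H; rewrite ltn_conjp.
Qed.

Lemma psub_refl la : psub la la.
Proof. by apply/psubP => i. Qed.

Lemma psub_trans nu mu la : psub mu nu -> psub nu la -> psub mu la.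
Proof.
by move=> /psubP H /psubP H'; apply/psubP => i; apply: leq_trans (H i) (H' i).
Qed.

Lemma psub_anti mu la : psub mu la -> psub la mu -> mu = la.
Proof.
move=> /psubP H /psubP H'; apply: intpart_ext => i.
by apply/eqP; rewrite eqn_leq H H'.
Qed.

Lemma row_emptyp i : row_len emptyp i = 0.
Proof. by rewrite /row_len nth_nil. Qed.

Lemma psub0 la : psub emptyp la.
Proof. by []. Qed.

(** [r] bounds the column heights from below and above; each height caps the next, and [v] caps the
    first. Enumerating shapes column by column leaves one number to remember, the last height, which
    suits a recursion on the columns. *)
Fixpoint dlists (v : nat) (r : seq (nat * nat)) : seq (seq nat) :=
  if r is p :: r' then
    [seq w :: t | w <- index_iota p.1 (minn p.2 v).+1, t <- dlists w r']
  else [:: [::]].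

Lemma mem_dlists v r h :
  (h \in dlists v r) = path geq v h && all2 (fun w p => p.1 <= w <= p.2) h r.
Proof.
elim: r v h => [|p r IHr] v [|w t] //=; first by rewrite inE !andbF.
  by apply/allpairsPdep => -[? [? [_ _]]].
apply/allpairsPdep/idP => [[w' [t' [wp tw [-> ->]]]]|].
  move: wp; rewrite mem_index_iota ltnS leq_min => /and3P[-> -> ->].
  by move: tw; rewrite IHr => /andP[-> ->].
move=> /andP[/andP[wv pw] /andP[/andP[pw1 pw2] tr]].
exists w, t; rewrite mem_index_iota ltnS leq_min pw1 pw2 /=; split=> //.
by rewrite IHr pw.
Qed.

Lemma uniq_dlists v r : uniq (dlists v r).
Proof.
elim: r v => //= p r IHr v; apply: allpairs_uniq_dep => //.
- exact: iota_uniq.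
- by move=> [w t] [w' t'] _ _ /= [-> ->].
Qed.

Definition colpairs (mu la : intpart) : seq (nat * nat) :=
  [seq (row_len (conjp mu) j, row_len (conjp la) j) | j <- iota 0 (row_len la 0)].

Definition between mu la : seq intpart :=
  if psub mu la then [seq of_cols h | h <- dlists (size la) (colpairs mu la)]
  else [::].

Lemma sorted_dlists v r h : h \in dlists v r -> sorted geq h.
Proof. by rewrite mem_dlists => /andP[/path_sorted]. Qed.

Lemma uniq_between mu la : uniq (between mu la).
Proof.
rewrite /between; case: ifP => // _; rewrite map_inj_in_uniq ?uniq_dlists //.
move=> h h' hd hd' E; have := hd; have := hd'; rewrite !mem_dlists !all2E.
move=> /and3P[_ /eqP s' _] /and3P[_ /eqP s _].
apply: (@eq_from_nth _ 0) => [|j _]; first by rewrite s s'.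
by rewrite -!row_conjp_of_cols ?E //; apply: sorted_dlists; eassumption.
Qed.

Lemma conjp_row0 la : row_len (conjp la) 0 = size la.
Proof. by apply: eq_ltn => i; rewrite ltn_conjp row_len_gt0. Qed.

Lemma nth_colpairs mu la j : psub mu la ->
  nth (0, 0) (colpairs mu la) j = (row_len (conjp mu) j, row_len (conjp la) j).
Proof.
move=> sub; have [jl|lj] := ltnP j (row_len la 0).
  by rewrite (nth_map 0) ?size_iota // nth_iota.
rewrite nth_default ?size_map ?size_iota //.
have E nu : psub nu la -> row_len (conjp nu) j = 0.
  move=> /psubP /(_ 0) nul; apply/eqP; rewrite -leqn0 leqNgt ltn_conjp -leqNgt.
  exact: leq_trans nul lj.
by rewrite !E ?psub_refl.
Qed.

Lemma all2_nth (S T : Type) (P : S -> T -> bool) x y s t : size s = size t ->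
  all2 P s t <-> (forall i, i < size s -> P (nth x s i) (nth y t i)).
Proof.
elim: s t => [|a s IHs] [|b t] //= [st].
split=> [/andP[Pab /IHs H] [|i] //= /H|H]; first by apply.
by rewrite (H 0) //=; apply/IHs => // i il; apply: (H i.+1).
Qed.

(** Transposition preserves containment, so a shape lies between [mu] and [la] when its column
    heights obey the bounds in [colpairs]; beyond the columns of [la] all heights are 0. *)
Lemma mem_between mu la nu : (nu \in between mu la) = psub mu nu && psub nu la.
Proof.
rewrite /between; have [sub|nsub] := boolP (psub mu la); last first.
  by apply/esym/negP => /andP[a b]; rewrite (psub_trans a b) in nsub.
apply/mapP/andP => [[h hd ->]|[munu nula]].
  have sh := sorted_dlists hd; move: hd; rewrite mem_dlists => /andP[_ h2].
  have sz : size h = size (colpairs mu la) by move: h2; rewrite all2E => /andP[/eqP].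
  move/(all2_nth _ 0 (0, 0) sz): h2 => h2.
  have E j : row_len (conjp mu) j <= nth 0 h j <= row_len (conjp la) j.
    have [jh|hj] := ltnP j (size h); first by have := h2 _ jh; rewrite nth_colpairs.
    rewrite nth_default // leqn0 -leqn0 /=.
    by have := nth_colpairs j sub; rewrite nth_default -?sz // => -[<- _].
  split; rewrite -psub_conj; apply/psubP => j; rewrite row_conjp_of_cols //.
    by case/andP: (E j).
  by case/andP: (E j).
pose h := [seq row_len (conjp nu) j | j <- iota 0 (row_len la 0)].
have hE : of_cols h = nu.
  apply: intpart_ext => i; rewrite row_len_of_cols count_map.
  apply: eq_ltn => j; rewrite count_downset /=.
    rewrite ltn_conjp; case: ltnP => //= lj; apply/esym/negbTE; rewrite -leqNgt.
    by apply: leq_trans lj; apply: leq_trans (row_len_leq _ (leq0n i)) (psubP _ _ nula 0).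
  by move=> k l kl; rewrite !ltn_conjp; apply: leq_trans.
exists h => //; rewrite mem_dlists; apply/andP; split.
  have pth : sorted geq h.
    apply: (homo_sorted (e := ltn)); last exact: iota_ltn_sorted.
    by move=> i j ij /=; apply: row_len_leq; apply: ltnW.
  have : all (geq (size la)) h.
    apply/allP => _ /mapP[j _ ->] /=; apply: leq_trans (row_len_leq _ (leq0n j)) _.
    by rewrite -conjp_row0; move: nula; rewrite -psub_conj => /psubP.
  by case: (h) pth => //= x t -> /andP[->].
have sz : size h = size (colpairs mu la) by rewrite !size_map.
apply/(all2_nth _ 0 (0, 0) sz) => j; rewrite size_map size_iota => jl.
rewrite nth_colpairs // (nth_map 0) ?size_iota // nth_iota //=.
by move: munu nula; rewrite -psub_conj => /psubP -> ; rewrite -psub_conj => /psubP ->.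
Qed.

End Shapes.

(** * Two letters, and chains of partitions *)

Section TwoLetters.
Variable R : comNzRingType.
Implicit Types (a b : R) (F G : nat -> R).

(** The weight of one column cut at height [w]: [a] if [nu / mu] meets the column, [b] if [la / nu]
    does. *)
Definition cell_wt a b (p : nat * nat) (w : nat) : R :=
  (if (p.1 < w)%N then a else 1) * (if (w < p.2)%N then b else 1).

Definition colsum a b (r : seq (nat * nat)) (v : nat) : R :=
  \sum_(h <- dlists v r) \prod_(x <- zip r h) cell_wt a b x.1 x.2.

Lemma colsum_nil a b v : colsum a b [::] v = 1.
Proof. by rewrite /colsum big_seq1 big_nil. Qed.

Lemma colsum_cons a b p r v : colsum a b (p :: r) v =
  \sum_(p.1 <= w < (minn p.2 v).+1) cell_wt a b p w * colsum a b r w.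
Proof.
rewrite /colsum big_allpairs_dep; apply: eq_bigr => w _.
by rewrite mulr_sumr; apply: eq_bigr => h _; rewrite big_cons.
Qed.

(* [F] and [G] are the sums over the columns to the right of the current one, as
   functions of the height of the current column, for the weights (a, b) and
   (b, a); the last clause is what makes the induction on columns go through. *)
Definition swap_inv a b F G (p : nat * nat) :=
  [/\ forall v, (p.2 <= v)%N -> F v = F p.2,
      forall v, (p.2 <= v)%N -> F v = G v &
      forall v U, (p.1 <= v)%N -> (v < U)%N -> (p.2 <= U)%N ->
        b * F v + a * F U + a * b * \sum_(v.+1 <= w < U) F w =
        a * G v + b * G U + a * b * \sum_(v.+1 <= w < U) G w].

(** In a column with [p.1 < p.2] the lowest cut carries only [b], the highest only [a], and those
    strictly between carry [a * b]. A cap below [p.2] removes the lone [a], which is the source of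
    the asymmetry. *)
Lemma step_low a b F (p : nat * nat) v : (p.1 <= v)%N -> (v < p.2)%N ->
  \sum_(p.1 <= w < (minn p.2 v).+1) cell_wt a b p w * F w =
  b * F p.1 + a * b * \sum_(p.1.+1 <= w < v.+1) F w.
Proof.
move=> lv vu; rewrite (minn_idPr (ltnW vu)) big_ltn ?ltnS //.
rewrite /cell_wt ltnn mul1r (leq_ltn_trans lv vu); congr (_ + _).
rewrite mulr_sumr; apply: eq_big_nat => w /andP[lw wv].
by rewrite lw (leq_trans wv vu).
Qed.

Lemma step_high a b F (p : nat * nat) v : (p.1 < p.2)%N -> (p.2 <= v)%N ->
  \sum_(p.1 <= w < (minn p.2 v).+1) cell_wt a b p w * F w =
  b * F p.1 + a * F p.2 + a * b * \sum_(p.1.+1 <= w < p.2) F w.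
Proof.
move=> lu uv; rewrite (minn_idPl uv) big_ltn ?ltnS ?(ltnW lu) // big_nat_recr //=.
rewrite /cell_wt !ltnn lu mul1r mulr1 addrA addrAC; congr (_ + _ + _).
rewrite mulr_sumr; apply: eq_big_nat => w /andP[lw wv].
by rewrite lw wv.
Qed.

Lemma step_flat a b F (p : nat * nat) v : p.1 = p.2 -> (p.2 <= v)%N ->
  \sum_(p.1 <= w < (minn p.2 v).+1) cell_wt a b p w * F w = F p.2.
Proof.
move=> lu uv; rewrite lu (minn_idPl uv) big_nat1 /cell_wt lu.
by rewrite ltnn /= !mul1r.
Qed.

(* [S] and [D v] are symmetric under the exchange of (a, F) and (b, G), by the last
   clause of [swap_inv]. *)
Lemma step_lowE a b F (p : nat * nat) v : (p.1 <= v)%N -> (v < p.2)%N ->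
  let S := b * F p.1 + a * F p.2 + a * b * \sum_(p.1.+1 <= w < p.2) F w in
  let D v := b * F v + a * F p.2 + a * b * \sum_(v.+1 <= w < p.2) F w in
  \sum_(p.1 <= w < (minn p.2 v).+1) cell_wt a b p w * F w = S - D v + b * F v.
Proof.
move=> lv vu S D; rewrite step_low // /S /D.
rewrite [\sum_(p.1.+1 <= w < p.2) _](@big_cat_nat _ _ _ v.+1) //=; ring.
Qed.

(** [q] is the column to the right of [p], no higher at either end, so its clauses apply at the
    heights of [p]. Uncapped, the new sum is an instance of the last clause for [q]; capped, it is
    symmetric up to the term [b * F v], and these terms cancel in the new last clause. *)
Lemma swap_inv_step a b F G (p q : nat * nat) :
  (p.1 <= p.2)%N -> (q.1 <= p.1)%N -> (q.2 <= p.2)%N ->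
  swap_inv a b F G q ->
  swap_inv a b
    (fun v => \sum_(p.1 <= w < (minn p.2 v).+1) cell_wt a b p w * F w)
    (fun v => \sum_(p.1 <= w < (minn p.2 v).+1) cell_wt b a p w * G w) p.
Proof.
move=> lu ql qu [Fc FG FD]; move: lu; rewrite leq_eqVlt => /orP[/eqP lu|lu].
  split=> [v uv|v uv|v U lv vU uU]; try by rewrite !step_flat ?FG.
  have uv : (p.2 <= v)%N by rewrite -lu.
  rewrite !step_flat // FG //.
  have -> : \sum_(v.+1 <= w < U) \sum_(p.1 <= i < (minn p.2 w).+1) cell_wt a b p i * F i
     = \sum_(v.+1 <= w < U) \sum_(p.1 <= i < (minn p.2 w).+1) cell_wt b a p i * G i.
    apply: eq_big_nat => w /andP[vw _]; have uw := leq_trans uv (ltnW vw).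
    by rewrite !step_flat // FG.
  ring.
set A := fun v => \sum_(_ <= w < _) cell_wt a b p w * F w.
set A' := fun v => \sum_(_ <= w < _) cell_wt b a p w * G w.
have AA' v : (p.2 <= v)%N -> A v = A' v.
  move=> uv; rewrite /A /A' !step_high // [b * a]mulrC; exact: FD.
have Ac v : (p.2 <= v)%N -> A v = A p.2.
  by move=> uv; rewrite /A !step_high.
split=> // v U lv vU uU.
have A'c w : (p.2 <= w)%N -> A' w = A p.2 by move=> uw; rewrite -AA' // Ac.
have [uv|vu] := leqP p.2 v.
  rewrite !A'c // !Ac //.
  have -> : \sum_(v.+1 <= w < U) A w = \sum_(v.+1 <= w < U) A' w.
    by apply: eq_big_nat => w /andP[vw _]; apply: AA'; apply: leq_trans uv (ltnW vw).
  by rewrite [b * _ + _]addrC.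
pose D w := b * F w + a * F p.2 + a * b * \sum_(w.+1 <= x < p.2) F x.
pose D' w := a * G w + b * G p.2 + b * a * \sum_(w.+1 <= x < p.2) G x.
have DD' w : (p.1 <= w)%N -> (w < p.2)%N -> D w = D' w.
  by move=> lw wu; rewrite /D /D' [b * a]mulrC; apply: FD => //; apply: leq_trans lw.
have SA : A p.2 = D p.1 by rewrite /A step_high.
have AE w : (p.1 <= w)%N -> (w < p.2)%N -> A w = A p.2 - D w + b * F w.
  by move=> lw wu; rewrite SA /A step_lowE.
have A'E w : (p.1 <= w)%N -> (w < p.2)%N -> A' w = A p.2 - D w + a * G w.
  by move=> lw wu; rewrite SA !DD' // /A' step_lowE.
have FGu : F p.2 = G p.2 by rewrite FG.
have cut H : \sum_(v.+1 <= w < U) H w =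
    \sum_(v.+1 <= w < p.2) H w + \sum_(p.2 <= w < U) H w :> R.
  exact: big_cat_nat.
rewrite (Ac U) // (A'c U) // (cut A) (cut A').
have -> : \sum_(p.2 <= w < U) A w = \sum_(p.2 <= w < U) A' w.
  by apply: eq_big_nat => w /andP[uw _]; apply: AA'.
set X := \sum_(p.2 <= w < U) A' w.
have -> : \sum_(v.+1 <= w < p.2) A w =
    \sum_(v.+1 <= w < p.2) (A p.2 - D w) + b * \sum_(v.+1 <= w < p.2) F w.
  rewrite mulr_sumr -big_split; apply: eq_big_nat => w /andP[vw wu] /=.
  by rewrite AE // (leq_trans lv) // ltnW.
have -> : \sum_(v.+1 <= w < p.2) A' w =
    \sum_(v.+1 <= w < p.2) (A p.2 - D w) + a * \sum_(v.+1 <= w < p.2) G w.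
  rewrite mulr_sumr -big_split; apply: eq_big_nat => w /andP[vw wu] /=.
  by rewrite A'E // (leq_trans lv) // ltnW.
(* On the left the terms in [F v] and in the sum of [F] add up to [b * (D v - a * F p.2)], which
   cancels [- b * D v]. What remains is [(a + b) * A p.2 - a * b * F p.2] plus sums common to both
   sides, symmetric since [F p.2 = G p.2]. The right side reduces likewise through [D']. *)
rewrite AE // A'E // [in RHS]DD' // /D /D' FGu.
ring.
Qed.

Definition cols_desc (r : seq (nat * nat)) :=
  all (fun p => p.1 <= p.2)%N r && sorted (fun p q => (q.1 <= p.1) && (q.2 <= p.2))%N r.

Lemma colsum_inv a b r : cols_desc r ->
  swap_inv a b (colsum a b r) (colsum b a r) (head (0, 0)%N r).
Proof.
elim: r => [_|p r IHr] /=.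
  split=> [v _|v _|v U _ _ _]; rewrite ?colsum_nil //.
  congr (_ + _ * _); last by apply: eq_bigr => w _; rewrite !colsum_nil.
  by rewrite !mulr1 addrC.
rewrite /cols_desc /= => /andP[/andP[lu ar] pr].
have {IHr} : swap_inv a b (colsum a b r) (colsum b a r) (head (0, 0)%N r).
  by apply: IHr; rewrite /cols_desc ar (path_sorted pr).
have [q1 q2] : ((head (0, 0) r).1 <= p.1)%N /\ ((head (0, 0) r).2 <= p.2)%N.
  by case: (r) pr => //= q r' /andP[/andP[]].
move/(swap_inv_step lu q1 q2) => [H1 H2 H3].
split=> [v|v|v U]; rewrite ?colsum_cons; [exact: H1|exact: H2|].
have E c d : \sum_(v.+1 <= w < U) colsum c d (p :: r) w = \sum_(v.+1 <= w < U)
    \sum_(p.1 <= i < (minn p.2 w).+1) cell_wt c d p i * colsum c d r i.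
  by apply: eq_bigr => w _; apply: colsum_cons.
by rewrite !E; apply: H3.
Qed.

Lemma colsumC a b r v : cols_desc r -> ((head (0, 0) r).2 <= v)%N ->
  colsum a b r v = colsum b a r v.
Proof. by move=> /(colsum_inv a b)[_ H _]; apply: H. Qed.

End TwoLetters.

(** The number of nonempty columns of [la / mu], thus the exponent of a letter filling exactly this
    skew shape. *)
Definition cdiff (mu la : intpart) : nat :=
  count (fun j => row_len (conjp mu) j < row_len (conjp la) j)%N (iota 0 (row_len la 0)).

Lemma row_conjp0 la j : (row_len la 0 <= j)%N -> row_len (conjp la) j = 0%N.
Proof. by move=> lj; apply/eqP; rewrite -leqn0 leqNgt ltn_conjp -leqNgt. Qed.

Lemma cdiff_wide mu la n : (row_len la 0 <= n)%N ->
  cdiff mu la = count (fun j => row_len (conjp mu) j < row_len (conjp la) j)%N (iota 0 n).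
Proof.
move=> ln; rewrite -(subnKC ln) iotaD count_cat add0n.
rewrite [X in (_ + X)%N](_ : _ = 0%N) ?addn0 //; apply/eqP.
rewrite eqn0Ngt -has_count; apply/hasPn => j; rewrite mem_iota => /andP[lj _].
by rewrite (@row_conjp0 la).
Qed.

Lemma prod_if_count (R : nzSemiRingType) (T : Type) (s : seq T) (P : pred T) (a : R) :
  \prod_(x <- s) (if P x then a else 1) = a ^+ count P s.
Proof.
elim: s => [|x s IHs]; first by rewrite big_nil.
by rewrite big_cons IHs /= exprD; case: (P x); rewrite ?expr1.
Qed.

Lemma between_row0 mu la nu : nu \in between mu la -> (row_len nu 0 <= row_len la 0)%N.
Proof. by rewrite mem_between => /andP[_ /psubP]; apply. Qed.

Lemma sum_between_colsum (R : comNzRingType) (a b : R) mu la : psub mu la ->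
  \sum_(nu <- between mu la) a ^+ cdiff mu nu * b ^+ cdiff nu la =
  colsum a b (colpairs mu la) (size la).
Proof.
move=> sub; rewrite big_seq (eq_bigr (fun nu =>
    a ^+ count (fun j => row_len (conjp mu) j < row_len (conjp nu) j)%N
           (iota 0 (row_len la 0)) * b ^+ cdiff nu la)); last first.
  by move=> nu /between_row0 nul; rewrite (cdiff_wide _ nul).
rewrite -big_seq /between sub big_map /colsum; apply: eq_big_seq => h hd.
have sh := sorted_dlists hd; move: hd; rewrite mem_dlists all2E => /and3P[_ /eqP sz _].
rewrite /cell_wt big_split /= !prod_if_count.
rewrite size_map size_iota in sz.
have {}sz : h = [seq nth 0%N h j | j <- iota 0 (row_len la 0)] by rewrite -sz;
  apply/esym/(mkseq_nth 0%N).
rewrite [zip _ _](_ : _ = [seq (row_len (conjp mu) j, row_len (conjp la) j, nth 0%N h j)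
    | j <- iota 0 (row_len la 0)]); last by rewrite {1}sz zip_map.
rewrite !count_map; congr (_ ^+ _ * _ ^+ _); apply: eq_count => j /=;
  by rewrite row_conjp_of_cols.
Qed.

Lemma cols_desc_colpairs mu la : psub mu la -> cols_desc (colpairs mu la).
Proof.
move=> sub; apply/andP; split.
  by apply/allP => _ /mapP[j _ ->] /=; apply/psubP; rewrite psub_conj.
apply: (homo_sorted (e := ltn)); last exact: iota_ltn_sorted.
by move=> i j ij /=; rewrite !row_len_leq // ltnW.
Qed.

Lemma sum_between_swap (R : comNzRingType) (a b : R) mu la : psub mu la ->
  \sum_(nu <- between mu la) a ^+ cdiff mu nu * b ^+ cdiff nu la =
  \sum_(nu <- between mu la) b ^+ cdiff mu nu * a ^+ cdiff nu la.
Proof.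
move=> sub; rewrite !sum_between_colsum // colsumC ?cols_desc_colpairs //.
by rewrite -nth0 nth_colpairs //= conjp_row0.
Qed.

Definition two_step mu la p q : nat :=
  (\sum_(nu <- between mu la) ((cdiff mu nu == p) && (cdiff nu la == q)))%N.

(** With independent variables over int, [two_step] is the coefficient of [x ^+ p * y ^+ q] in the
    two-letter sum, and natural numbers can be compared there. *)
Lemma two_stepC mu la p q : psub mu la -> two_step mu la p q = two_step mu la q p.
Proof.
move=> sub; pose x : {poly {poly int}} := 'X; pose y : {poly {poly int}} := 'X%:P.
have E i j : ((x ^+ i * y ^+ j)`_p)`_q = ((i == p) && (j == q))%:R.
  rewrite /x /y -rmorphXn coefMC coefXn -[X in X * _](@rmorph_nat _ _ polyC) coefCM coefXn.
  by rewrite -natrM mulnb [p == _]eq_sym [q == _]eq_sym.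
have E' i j : ((y ^+ i * x ^+ j)`_p)`_q = ((i == q) && (j == p))%:R.
  by rewrite mulrC E andbC.
have := congr1 (fun u : {poly {poly int}} => (u`_p)`_q) (sum_between_swap x y sub).
rewrite !coef_sum; under eq_bigr do rewrite E.
under [RHS]eq_bigr do rewrite E'.
by rewrite -!natr_sum => /eqP; rewrite Num.Theory.eqr_nat => /eqP.
Qed.

(** The coefficient of [x^s] in g of [la / mu], kept in nat so that it is nonzero exactly when a
    chain exists. Links may be trivial, which accounts for exponents 0. *)
Fixpoint nchain (mu la : intpart) (s : seq nat) : nat :=
  if s is p :: s' then (\sum_(nu <- between mu la | cdiff mu nu == p) nchain nu la s')%N
  else (mu == la).

Lemma exchange_between (V : nmodType) mu la (F : intpart -> intpart -> V) :
  \sum_(nu <- between mu la) \sum_(ka <- between nu la) F nu ka =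
  \sum_(ka <- between mu la) \sum_(nu <- between mu ka) F nu ka.
Proof.
transitivity (\sum_(nu <- between mu la) \sum_(ka <- between mu la | psub nu ka) F nu ka).
  apply: eq_big_seq => nu; rewrite mem_between => /andP[mn nl].
  rewrite -[RHS]big_filter; apply: perm_big; apply: uniq_perm;
    rewrite ?filter_uniq ?uniq_between //.
  move=> ka; rewrite mem_filter !mem_between; apply/andP/and3P => [[nk kl]|[nk mk kl]] //.
  by split=> //; apply: psub_trans nk.
rewrite (exchange_big_dep xpredT) //=; apply: eq_big_seq => ka;
  rewrite mem_between => /andP[mk kl].
rewrite -big_filter; apply: perm_big; apply: uniq_perm;
  rewrite ?filter_uniq ?uniq_between //.
move=> nu; rewrite mem_filter !mem_between; apply/and3P/andP => [[nk mn nl]|[mn nk]] //.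
by split=> //; apply: psub_trans kl.
Qed.

Lemma nchain_swap mu la p q s : nchain mu la [:: p, q & s] = nchain mu la [:: q, p & s].
Proof.
have E p' q' : nchain mu la [:: p', q' & s] =
    (\sum_(ka <- between mu la) two_step mu ka p' q' * nchain ka la s)%N.
  rewrite /= big_mkcond /=.
  transitivity (\sum_(nu <- between mu la) \sum_(ka <- between nu la)
     ((cdiff mu nu == p') && (cdiff nu ka == q')) * nchain ka la s)%N.
    apply: eq_bigr => nu _; case: eqP => _; last by rewrite big1.
    by rewrite big_mkcond; apply: eq_bigr => ka _; case: eqP => _ /=; rewrite ?mul1n.
  rewrite exchange_between; apply: eq_bigr => ka _; rewrite /two_step big_distrl /=.
  by [].
rewrite !E; apply: eq_big_seq => ka; rewrite mem_between => /andP[mk _].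
by rewrite two_stepC.
Qed.

(** [nchain_swap] reaches only the first two letters; deeper swaps are obtained by fixing the first
    link and rearranging the rest of the chain. *)
Lemma nchain_perm mu la s t : perm_eq s t -> nchain mu la s = nchain mu la t.
Proof.
have move_front x t1 t2 : forall nu, nchain nu la (t1 ++ x :: t2) = nchain nu la (x :: t1
  ++ t2).
  elim: t1 => [|y t1 IHt] nu //; rewrite [RHS]nchain_swap.
  by rewrite /=; apply: eq_bigr => ka _; apply: IHt.
elim: s t mu => [|x s IHs] t mu st.
  by rewrite perm_sym in st; rewrite (perm_nilP st).
have xt : x \in t by rewrite -(perm_mem st) mem_head.
case/splitPr: xt st => t1 t2 st.
rewrite move_front /=; apply: eq_bigr => nu _; apply: IHs.
by rewrite -(perm_cons x) (perm_trans st) // perm_catC /= perm_cons perm_catC.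
Qed.

(** The recursion peels off the first link; exchanging the double sum over the inner shapes gives
    access to the last one, without using the symmetry. *)
Lemma nchain_rcons mu la s p : nchain mu la (rcons s p) =
  (\sum_(nu <- between mu la | cdiff nu la == p) nchain mu nu s)%N.
Proof.
elim: s mu => [|q s IHs] mu.
  have [sub|nsub] := boolP (psub mu la); last first.
    by rewrite /= /between (negbTE nsub) !big_nil.
  rewrite /= !(big_mkcond (fun nu => cdiff _ _ == _)) /=.
  rewrite (bigD1_seq la) ?uniq_between ?mem_between ?sub ?psub_refl //= eqxx.
  rewrite big1 ?addn0; last by move=> nu /negbTE ->; case: ifP.
  rewrite (bigD1_seq mu) ?uniq_between ?mem_between ?sub ?psub_refl //= eqxx.
  by rewrite big1 ?addn0 // => nu /negbTE; rewrite eq_sym => ->; case: ifP.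
transitivity (\sum_(nu <- between mu la) \sum_(ka <- between nu la)
     if (cdiff mu nu == q) && (cdiff ka la == p) then nchain nu ka s else 0)%N.
  rewrite /= big_mkcond; apply: eq_bigr => nu _; case: eqP => _ /=; last by rewrite big1.
  by rewrite IHs big_mkcond.
rewrite exchange_between [RHS]big_mkcond; apply: eq_bigr => ka _ /=.
rewrite [in RHS]big_mkcond; case: eqP => _.
  by apply: eq_bigr => nu _; rewrite andbT.
by rewrite big1 // => nu _; rewrite andbF.
Qed.

(** * Dominance and unitriangularity *)

Section Triangular.
Local Open Scope nat_scope.

Lemma sum_ltn c n : c <= n -> \sum_(0 <= j < n) (j < c) = c.
Proof.
move=> cn; rewrite (@big_cat_nat _ _ _ c) //= (eq_big_nat _ _ (F2 := fun=> 1)); last first.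
  by move=> j /andP[_ ->].
rewrite sum_nat_const_nat muln1 subn0 big_nat big1 ?addn0 // => j /andP[cj _].
by rewrite ltnNge cj.
Qed.

Lemma sumn_count h n : all (geq n) h ->
  sumn h = \sum_(0 <= j < n) count (fun c => j < c) h.
Proof.
elim: h => [|c h IHh] /=; first by rewrite big1.
move=> /andP[cn /IHh ->]; rewrite big_split /=; congr (_ + _).
exact/esym/sum_ltn.
Qed.

Lemma leq_sum_eq (f g : nat -> nat) n : (forall j, f j <= g j) ->
  \sum_(0 <= j < n) f j = \sum_(0 <= j < n) g j -> forall j, j < n -> f j = g j.
Proof.
move=> fg E j jn; apply/eqP; rewrite eqn_leq fg /= leqNgt; apply/negP => lt.
suff : \sum_(0 <= j < n) f j < \sum_(0 <= j < n) g j by rewrite E ltnn.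
have jr : j \in index_iota 0 n by rewrite mem_index_iota.
rewrite (bigD1_seq j) ?iota_uniq //= [X in _ < X](bigD1_seq j) ?iota_uniq //=.
by rewrite -addSn; apply: leq_add => //; apply: leq_sum.
Qed.

Lemma row_bound (la : intpart) n : row_len la 0 <= n -> all (geq n) la.
Proof.
move=> ln; apply/allP => c /(nthP 0)[i _ <-] /=; apply: leq_trans ln.
exact: (row_len_leq la (leq0n i)).
Qed.

Lemma sumn_conj (la : intpart) n : row_len la 0 <= n ->
  sumn la = \sum_(0 <= j < n) row_len (conjp la) j.
Proof.
move=> ln; rewrite (sumn_count (row_bound ln)).
by apply: eq_bigr => j _; rewrite row_len_of_cols.
Qed.

Lemma sumn_take_nth (h : seq nat) n : sumn (take n h) = \sum_(0 <= i < n) nth 0 h i.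
Proof.
elim: n => [|n IHn]; first by rewrite take0 big_nil.
rewrite big_nat_recr //= -IHn; have [nl|ln] := ltnP n (size h).
  by rewrite (take_nth 0) // sumn_rcons.
by rewrite !take_oversize ?nth_default ?addn0 // ltnW.
Qed.

Lemma sumn_take (la : intpart) n : sumn (take n la) = \sum_(0 <= i < n) row_len la i.
Proof. exact: sumn_take_nth. Qed.

Lemma size_sumn (la : intpart) : size la <= sumn la.
Proof.
have /andP[_] := valP la; rewrite /=; elim: (parts la) => //= c h IHh.
rewrite inE negb_or eq_sym -lt0n => /andP[c0 /IHh hh].
by rewrite -add1n leq_add.
Qed.

Lemma sumn_rows (la : intpart) n : size la <= n -> sumn la = \sum_(0 <= i < n) row_len la i.
Proof. by move=> ln; rewrite -sumn_take take_oversize. Qed.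

Lemma row_len_sumn (la : intpart) : row_len la 0 <= sumn la.
Proof. by rewrite /row_len; case: (la : seq nat) => //= c h; apply: leq_addr. Qed.

Lemma cdiff_conj mu la j : psub mu la ->
  row_len (conjp mu) j + (row_len (conjp mu) j < row_len (conjp la) j) <= row_len (conjp
    la) j.
Proof.
rewrite -psub_conj => /psubP /(_ j).
by rewrite leq_eqVlt => /orP[/eqP ->|lt]; rewrite ?ltnn ?addn0 // lt addn1.
Qed.

Lemma sum_cdiff mu la n : psub mu la -> row_len la 0 <= n ->
  sumn mu + cdiff mu la = \sum_(0 <= j < n)
    (row_len (conjp mu) j + (row_len (conjp mu) j < row_len (conjp la) j)).
Proof.
move=> sub ln; rewrite (cdiff_wide _ ln) -sum1_count big_split /=; congr (_ + _).
  by apply: sumn_conj; apply: leq_trans ln; apply/psubP.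
by rewrite big_mkcond /index_iota subn0; apply: eq_bigr => j _; case: ifP.
Qed.

Lemma sumn_cdiff mu la : psub mu la -> sumn mu + cdiff mu la <= sumn la.
Proof.
move=> sub; rewrite (sum_cdiff sub (leqnn _)) (sumn_conj (leqnn _)).
by apply: leq_sum => j _; apply: cdiff_conj.
Qed.

(** Equality means that no column gains more than one box; this is applied to the first column,
    whose height is [size]. *)
Lemma horizontal_strip mu la : psub mu la -> sumn mu + cdiff mu la = sumn la ->
  size la <= (size mu).+1.
Proof.
move=> sub; rewrite (sum_cdiff sub (leqnSn _)) (sumn_conj (leqnSn _)) => /leq_sum_eq E.
rewrite -!conjp_row0 -{}E //; last by move=> j; apply: cdiff_conj.
by rewrite -addn1 leq_add2l leq_b1.
Qed.

Lemma sumn_psub mu la : psub mu la -> sumn mu <= sumn la.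
Proof. by move/sumn_cdiff; apply: leq_trans; apply: leq_addr. Qed.

Lemma psub_eq mu la : psub mu la -> sumn mu = sumn la -> mu = la.
Proof.
move=> /psubP sub E; apply: intpart_ext => i.
pose n := maxn i.+1 (maxn (size mu) (size la)).
move: E; rewrite (@sumn_rows mu n) ?(@sumn_rows la n) ?leq_max ?leqnn ?orbT // => E.
by apply: (leq_sum_eq sub E); rewrite leq_max leqnn.
Qed.

Lemma nchain_cons_neq0 mu la p s : nchain mu la (p :: s) != 0 ->
  exists nu, [/\ psub mu nu, psub nu la, cdiff mu nu = p & nchain nu la s != 0].
Proof.
rewrite sum_nat_seq_neq0 => /hasP[nu];
  rewrite mem_between => /andP[mn nl] /andP[/eqP cd nz].
by exists nu.
Qed.

Lemma nchain_rcons_neq0 mu la p s : nchain mu la (rcons s p) != 0 ->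
  exists nu, [/\ psub mu nu, psub nu la, cdiff nu la = p & nchain mu nu s != 0].
Proof.
rewrite nchain_rcons sum_nat_seq_neq0 => /hasP[nu]; rewrite mem_between.
by move=> /andP[mn nl] /andP[/eqP cd nz]; exists nu.
Qed.

Lemma nchain_sumn mu la s : nchain mu la s != 0 -> sumn mu + sumn s <= sumn la.
Proof.
elim: s mu => [|p s IHs] mu.
  by rewrite /= addn0 eqb0 negbK => /eqP ->.
move/nchain_cons_neq0 => [nu [mn _ cd /IHs]]; apply: leq_trans.
by rewrite /= addnA leq_add2r -cd; apply: sumn_cdiff.
Qed.

(** When the content is as large as [la], every link is a horizontal strip and the chain is a
    semistandard tableau, whose [j] smallest letters lie in the first [j] rows. After removing the
    last letter, both size inequalities are forced to be equalities. *)
Lemma nchain_dominance la s : nchain emptyp la s != 0 -> sumn s = sumn la ->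
  size la <= size s /\ forall j, sumn (take j s) <= sumn (take j la).
Proof.
elim/last_ind: s la => [|s p IHs] la.
  by rewrite /= eqb0 negbK => /eqP <-.
move=> /nchain_rcons_neq0[nu [_ nl cd nz]]; rewrite sumn_rcons => E.
have := nchain_sumn nz; rewrite add0n => sn.
have := sumn_cdiff nl; rewrite cd -E leq_add2r => ns.
have {ns} sn : sumn s = sumn nu by apply/eqP; rewrite eqn_leq sn ns.
have [sz dom] := IHs _ nz sn.
have szl : size la <= (size s).+1.
  by apply: leq_trans (horizontal_strip nl _) _; rewrite ?cd -?sn ?ltnS.
rewrite size_rcons; split=> // j; have [js|sj] := leqP j (size s).
  rewrite -cats1 takel_cat //; apply: leq_trans (dom j) _.
  by rewrite !sumn_take; apply: leq_sum => i _; apply/psubP.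
by rewrite !take_oversize ?size_rcons // ?(leq_trans szl) // sumn_rcons E.
Qed.

(** The Kostka number of shape and content [la] is 1: the shape before the last link has at most as
    many rows as there are letters left, so it lies inside [la] without its last row, and equals it
    by size. *)
Lemma nchain_diag (la : intpart) : nchain emptyp la la = 1.
Proof.
have [n] := ubnP (size la); elim: n la => // n IHn la; rewrite ltnS => sz.
case/lastP E : (la : seq nat) => [|s p].
  by rewrite /= (_ : emptyp = la) ?eqxx //; apply: val_inj; rewrite /= E.
have s_part : is_intpart s.
  have := valP la; rewrite /= E /is_intpart => /andP[so]; rewrite mem_rcons inE negb_or.
  move=> /andP[_ ->]; rewrite andbT.
  by move: so; rewrite -cats1 => /cat_sorted2[].
pose nu0 := IntPart s_part.
have row0 i : i < size s -> row_len nu0 i = row_len la i.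
  by move=> si; rewrite /row_len /= E nth_rcons si.
have sub0 : psub nu0 la by apply/allP => i; rewrite mem_iota => /andP[_ si]; rewrite row0.
have cd0 : cdiff nu0 la = p.
  rewrite /cdiff -sum1_count big_mkcond /=.
  rewrite (eq_bigr (fun j => (j < p) : nat)) => [|j _].
    have -> : iota 0 (row_len la 0) = index_iota 0 (row_len la 0) by rewrite /index_iota
      subn0.
    rewrite sum_ltn //; apply: leq_trans (row_len_leq la (leq0n (size s))).
    by rewrite /row_len E nth_rcons ltnn eqxx.
  rewrite !row_len_of_cols E -cats1 count_cat /= addn0 -[X in X < _]addn0 ltn_add2l lt0b.
  by case: ifP.
rewrite nchain_rcons big_mkcond (bigD1_seq nu0) ?uniq_between ?mem_between ?sub0 //=.
rewrite cd0 eqxx.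
rewrite (IHn nu0) /=; last by rewrite (leq_trans _ sz) // E size_rcons.
rewrite big1_seq // => nu /andP[nn]; rewrite mem_between => /andP[_ nl].
case: eqP => // cd.
apply/eqP; apply: contraNT nn => nz.
have := nchain_sumn nz; rewrite add0n => sn.
have sumla : sumn la = sumn s + p by rewrite E sumn_rcons.
have := sumn_cdiff nl; rewrite cd sumla leq_add2r => ns.
have {}sn : sumn s = sumn nu by apply/eqP; rewrite eqn_leq sn ns.
have [szn _] := nchain_dominance nz sn.
apply/eqP; apply: psub_eq; last by rewrite -sn.
apply/allP => i; rewrite mem_iota => /andP[_ si]; rewrite row0 ?(leq_trans si) //.
exact/psubP.
Qed.

(* The sum is at most d^2 for a partition of d, so the cube makes [prank] increase with
   the size; on partitions of the same size it increases in the dominance order. *)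
Definition prank (la : intpart) : nat :=
  sumn la ^ 3 + \sum_(0 <= j < sumn la) sumn (take j la).

Lemma sumn_take_leq (h : seq nat) j : sumn (take j h) <= sumn h.
Proof. by rewrite -{2}(cat_take_drop j h) sumn_cat leq_addr. Qed.

Lemma prank_sumn (mu la : intpart) : sumn mu < sumn la -> prank mu < prank la.
Proof.
move=> lt; apply: leq_trans (leq_addr _ _).
have le : \sum_(0 <= j < sumn mu) sumn (take j mu) <= sumn mu * sumn mu.
  apply: leq_trans (leq_sum _ (fun j _ => sumn_take_leq mu j)) _.
  by rewrite sum_nat_const_nat subn0.
rewrite /prank; have {lt} : (sumn mu).+1 ^ 3 <= sumn la ^ 3 by rewrite leq_exp2r.
apply: leq_trans; rewrite -addnS.
move: le; set x := sumn mu; set y := \sum_(_ <= _ < _) _; nia.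
Qed.

(** Among partitions of one size the rank is, up to a constant, the sum of the partial sums. These
    are compared termwise by dominance, so equal ranks force equal partial sums and hence equal
    partitions. *)
Lemma nchain_tri (la mu : intpart) : nchain emptyp la mu != 0 ->
  mu = la \/ prank mu < prank la.
Proof.
move=> nz; have := nchain_sumn nz; rewrite add0n leq_eqVlt => /orP[/eqP E|]; last first.
  by move/prank_sumn; right.
have [_ dom] := nchain_dominance nz E.
have : prank mu <= prank la by rewrite /prank E leq_add2l; apply: leq_sum => j _.
rewrite leq_eqVlt => /orP[/eqP|]; last by right.
rewrite /prank E => /addnI /leq_sum_eq Ej; left.
have take_eq j : sumn (take j mu) = sumn (take j la).
  have [jl|lj] := ltnP j (sumn la); first exact: Ej.
  by rewrite !take_oversize // ?(leq_trans (size_sumn _)) ?E.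
apply: intpart_ext => i; have := take_eq i.+1; rewrite !sumn_take !big_nat_recr //=.
by rewrite -!sumn_take take_eq => /addnI.
Qed.

(** Built from columns of height 1, so that [k = 0] gives the empty partition and no forbidden zero
    part. *)
Definition rowp (k : nat) : intpart := of_cols (nseq k 1).

Lemma row_len_rowp k i : row_len (rowp k) i = if i is 0 then k else 0.
Proof. by rewrite row_len_of_cols count_nseq; case: i => [|i]; rewrite ?mul1n ?mul0n. Qed.

Lemma conjp_rowp k j : row_len (conjp (rowp k)) j = (j < k).
Proof.
rewrite row_conjp_of_cols; last by elim: k => //= -[].
by rewrite nth_nseq; case: ltnP.
Qed.

Lemma psub_rowp nu k : psub nu (rowp k) -> nu = rowp (row_len nu 0).
Proof.
move=> /psubP sub; apply: intpart_ext => -[|i]; rewrite row_len_rowp //.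
by apply/eqP; rewrite -leqn0; have := sub i.+1; rewrite row_len_rowp.
Qed.

Lemma psub_rowps j k : psub (rowp j) (rowp k) = (j <= k).
Proof.
by apply/psubP/idP => [/(_ 0)|jk [|i]]; rewrite !row_len_rowp.
Qed.

Lemma cdiff_rowp j k : j <= k -> cdiff (rowp j) (rowp k) = k - j.
Proof.
move=> jk; have kE : iota 0 k = iota 0 j ++ iota j (k - j) by rewrite -iotaD subnKC.
rewrite /cdiff row_len_rowp kE count_cat.
rewrite [X in X + _](_ : _ = 0) ?add0n; last first.
  apply/eqP; rewrite eqn0Ngt -has_count; apply/hasPn => i; rewrite mem_iota add0n.
  by move=> /andP[_ ij]; rewrite !conjp_rowp ij (leq_trans ij jk).
rewrite -{2}(size_iota j (k - j)); apply/eqP; rewrite -all_count; apply/allP => i.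
by rewrite mem_iota subnKC // !conjp_rowp => /andP[ji ->]; rewrite [i < j]ltnNge ji.
Qed.

Lemma rowp_inj : injective rowp.
Proof. by move=> j k /(congr1 (row_len^~ 0)); rewrite !row_len_rowp. Qed.

(** A row contains one row of each smaller length, so its content determines the chain. This is what
    identifies the Schur function of a row with h_k. *)
Lemma nchain_rowp j k s : nchain (rowp j) (rowp k) s = (k == j + sumn s).
Proof.
elim: s j => [|p s IHs] j /=; first by rewrite addn0 (inj_eq rowp_inj) eq_sym.
have [le|lt] := leqP (j + p) k.
  rewrite big_mkcond (bigD1_seq (rowp (j + p))) ?uniq_between ?mem_between ?psub_rowps
    ?le ?leq_addr //=.
  rewrite cdiff_rowp ?leq_addr // addKn eqxx.
  rewrite IHs addnA big1_seq ?addn0 // => nu /andP[nn].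
  rewrite mem_between => /andP[jn nk]; case: eqP => // cd; move: cd nn;
    rewrite (psub_rowp nk) in jn *.
  rewrite psub_rowps in jn; rewrite cdiff_rowp // => <-.
  by rewrite subnKC // eqxx.
rewrite big1_seq => [|nu /andP[/eqP cd]].
  by apply/esym/eqP; rewrite eqb0; apply: contraTN lt => /eqP ->;
    rewrite -leqNgt leq_add2l leq_addr.
rewrite mem_between => /andP[jn nk]; have nuE := psub_rowp nk.
move: (row_len nu 0) nuE => i nuE; subst nu; move: cd lt.
rewrite !psub_rowps in jn nk; rewrite cdiff_rowp // => <-.
by rewrite subnKC // ltnNge nk.
Qed.

Lemma cdiff0 la : cdiff emptyp la = row_len la 0.
Proof.
rewrite /cdiff -{2}(size_iota 0 (row_len la 0)); apply/eqP; rewrite -all_count.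
apply/allP => j; rewrite mem_iota => /andP[_ jl].
by rewrite row_conjp0 ?row_emptyp // ltn_conjp.
Qed.

Lemma nchain1 mu la k : psub mu la -> nchain mu la [:: k] = (cdiff mu la == k).
Proof.
move=> sub; rewrite /= big_mkcond (bigD1_seq la) ?uniq_between ?mem_between ?sub
  ?psub_refl //=.
rewrite eqxx big1 ?addn0; first by case: ifP.
by move=> nu /negbTE ->; case: ifP.
Qed.

End Triangular.

(** * Reverse plane partitions as chains *)

Section Boxes.
Local Open Scope nat_scope.
Variable la : intpart.
Implicit Types mu nu : intpart.

Lemma box_bounds mu (c : box la mu) : row_len mu (brow c) <= bcol c < row_len la (brow c).
Proof. exact: (valP c). Qed.

Lemma mkbox mu i j : row_len mu i <= j -> j < row_len la i ->
  exists c : box la mu, (brow c = i :> nat) /\ (bcol c = j :> nat).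
Proof.
move=> mj jl.
have il : i < size la by rewrite -row_len_gt0 (leq_ltn_trans _ jl).
have j0 : j < row_len la 0 by apply: leq_trans jl (row_len_leq la _).
have cP : row_len mu (Ordinal il, Ordinal j0).1 <= (Ordinal il, Ordinal j0).2
  < row_len la (Ordinal il, Ordinal j0).1 by rewrite mj.
by exists (exist _ (Ordinal il, Ordinal j0) cP).
Qed.

Lemma box_inj mu (c d : box la mu) : brow c = brow d -> bcol c = bcol d -> c = d.
Proof.
rewrite /brow /bcol => r k; apply: val_inj.
by rewrite (surjective_pairing (val c)) (surjective_pairing (val d)) r k.
Qed.

Lemma box_sub mu nu (c : box la mu) : row_len nu (brow c) <= bcol c ->
  exists c' : box la nu, val c' = val c.
Proof.
move=> nc; have cP : row_len nu (val c).1 <= (val c).2 < row_len la (val c).1.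
  by rewrite nc; case/andP: (valP c).
by exists (exist _ (val c) cP).
Qed.

Lemma box_emb mu nu (c : box la nu) : psub mu nu -> exists c' : box la mu, val c' = val c.
Proof.
move=> /psubP mn; apply: box_sub; apply: leq_trans (mn _) _.
by case/andP: (box_bounds c).
Qed.

(* The boxes of nu / mu get the smallest letter, the other entries are shifted. *)
Definition lift_filling mu nu (T : filling la nu) : filling la mu :=
  [ffun c : box la mu => if insub (val c) is Some c' then (T c').+1 else 0].

Lemma lift_val mu nu (T : filling la nu) (c : box la mu) (c' : box la nu) :
  val c' = val c -> lift_filling mu T c = (T c').+1.
Proof. by move=> E; rewrite ffunE -E valK. Qed.

Lemma lift_eq0 mu nu (T : filling la nu) (c : box la mu) :
  (lift_filling mu T c == 0) = (bcol c < row_len nu (brow c)).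
Proof.
have [cn|nc] := ltnP (bcol c) (row_len nu (brow c)).
  rewrite ffunE insubF //; apply: negbTE; rewrite negb_and -ltnNge.
  by apply/orP; left.
by have [c' E] := box_sub nc; rewrite (lift_val T E).
Qed.

Lemma lift_is_rpp mu nu (T : filling la nu) : psub mu nu ->
  is_rpp (lift_filling mu T) <-> is_rpp T.
Proof.
move=> mn; split=> -[Tr Tc].
  split=> c d E le; have [c' cE] := box_emb c mn; have [d' dE] := box_emb d mn;
    rewrite -ltnS -(lift_val T (esym cE)) -(lift_val T (esym dE)).
    by apply: Tr; rewrite /brow /bcol ?cE ?dE.
  by apply: Tc; rewrite /brow /bcol ?cE ?dE.
split=> c d E le.
  have [->//|] := posnP (lift_filling mu T c); rewrite lt0n lift_eq0 -leqNgt => nc.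
  have nd : row_len nu (brow d) <= bcol d by rewrite -E (leq_trans nc).
  have [c' cE] := box_sub nc; have [d' dE] := box_sub nd.
  rewrite (lift_val T cE) (lift_val T dE) ltnS.
  by apply: Tr; rewrite /brow /bcol ?cE ?dE.
have [->//|] := posnP (lift_filling mu T c); rewrite lt0n lift_eq0 -leqNgt => nc.
have nd : row_len nu (brow d) <= bcol d by rewrite -E (leq_trans _ nc) // row_len_leq.
have [c' cE] := box_sub nc; have [d' dE] := box_sub nd.
rewrite (lift_val T cE) (lift_val T dE) ltnS.
by apply: Tc; rewrite /brow /bcol ?cE ?dE.
Qed.

Lemma card_ord_count n (P : pred nat) : #|[set j : 'I_n | P j]%SET| = count P (iota 0 n).
Proof. by rewrite cardsE cardE size_filter -enumT -val_enum_ord count_map;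
  apply: eq_count. Qed.

Lemma ncols_lift0 mu nu (T : filling la nu) : psub mu nu -> psub nu la ->
  ncols (lift_filling mu T) 0 = cdiff mu nu.
Proof.
move=> mn nl; rewrite (cdiff_wide mu (n := row_len la 0)); last exact/psubP.
rewrite -card_ord_count; apply: eq_card => j; rewrite !inE.
apply/existsP/idP => [[c /andP[/eqP <-]]|lt].
  rewrite lift_eq0 -ltn_conjp; apply: leq_ltn_trans.
  by rewrite leqNgt ltn_conjp -leqNgt; case/andP: (box_bounds c).
(* The first box of column [j] below [mu] belongs to [nu / mu]. *)
have [||c [cr cc]] := @mkbox mu (row_len (conjp mu) j) j.
- by rewrite leqNgt -ltn_conjp ltnn.
- by apply: leq_trans (psubP _ _ nl _); rewrite -ltn_conjp.
exists c; apply/andP; split; first exact/eqP/val_inj.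
by rewrite lift_eq0 cr cc -ltn_conjp.
Qed.

Lemma ncols_liftS mu nu (T : filling la nu) i : psub mu nu ->
  ncols (lift_filling mu T) i.+1 = ncols T i.
Proof.
move=> mn; apply: eq_card => j; rewrite !inE.
apply/existsP/existsP => -[c /andP[/eqP cj /eqP Tc]].
  have : ~~ (lift_filling mu T c == 0) by rewrite Tc.
  rewrite lift_eq0 -leqNgt => /box_sub[c' cE]; exists c'.
  rewrite /bcol cE -/(bcol c) cj eqxx /=.
  by move: Tc; rewrite (lift_val T cE) => -[->].
have [c' cE] := box_emb c mn; exists c'.
by rewrite (lift_val T (esym cE)) Tc eqxx /bcol cE -/(bcol c) cj eqxx.
Qed.

Lemma lift_inj mu nu : psub mu nu -> injective (@lift_filling mu nu).
Proof.
move=> mn T T' E; apply/ffunP => c; have [c' cE] := box_emb c mn.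
apply: succn_inj; rewrite -(lift_val T (esym cE)) E.
exact: (lift_val T' (esym cE)).
Qed.

(** The zeros determine [nu] only among the boxes of [la / mu]; the containments supply the rest. *)
Lemma lift_shape mu nu nu' (T : filling la nu) (T' : filling la nu') :
  psub mu nu -> psub mu nu' -> psub nu la -> psub nu' la ->
  lift_filling mu T = lift_filling mu T' -> nu = nu'.
Proof.
move=> mn mn' nl nl' E.
have H i j : (j < row_len mu i) || (j < row_len la i) && (j < row_len nu i) =
             (j < row_len mu i) || (j < row_len la i) && (j < row_len nu' i).
  case: (ltnP j (row_len mu i)) => //= mj; case: (ltnP j (row_len la i)) => //= jl.
  have [c [<- <-]] := mkbox mj jl.
  by rewrite -(lift_eq0 T) E (lift_eq0 T').
have H' ka i j : psub mu ka -> psub ka la ->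
    (j < row_len mu i) || (j < row_len la i) && (j < row_len ka i) = (j < row_len ka i).
  move=> /psubP mk /psubP kl; apply/orP/idP => [[|/andP[]] //|jk].
    by move/leq_trans; apply.
  by right; rewrite jk (leq_trans jk).
by apply: intpart_ext => i; apply: eq_ltn => j; rewrite -(H' nu i j) // H H'.
Qed.

(** Since entries increase weakly along rows and columns, the boxes with entry 0 together with [mu]
    form a Young diagram, which is the required [nu]. *)
Lemma unlift mu (T : filling la mu) : psub mu la -> is_rpp T ->
  exists nu, [/\ psub mu nu, psub nu la & exists T' : filling la nu, T = lift_filling mu
    T'].
Proof.
move=> ml [Tr Tc].
pose Q i j := (j < row_len mu i) ||
  [exists c : box la mu, [&& brow c == i :> nat, bcol c == j :> nat & T c == 0]].
have Qla i j : Q i j -> j < row_len la i.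
  case/orP=> [jm|/existsP[c /and3P[/eqP <- /eqP <- _]]].
    exact: leq_trans jm (psubP _ _ ml i).
  by case/andP: (box_bounds c).
have Qrow i j j' : j' <= j -> Q i j -> Q i j'.
  move=> jj Qij; have := Qla _ _ Qij; move: Qij; rewrite /Q.
  case: (ltnP j' (row_len mu i)) => //= mj'; rewrite ltnNge (leq_trans mj' jj) /=.
  move=> /existsP[c /and3P[/eqP ci /eqP cj T0]] jl.
  have [d [di dj]] := mkbox mj' (leq_ltn_trans jj jl).
  apply/existsP; exists d; rewrite di dj !eqxx /=.
  have : T d <= T c by apply: Tr; rewrite ?dj ?cj //; apply: val_inj; rewrite /= di ci.
  by rewrite (eqP T0) leqn0.
have Qcol j i i' : i' <= i -> Q i j -> Q i' j.
  move=> ii Qij; have := Qla _ _ Qij; move: Qij; rewrite /Q.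
  case: (ltnP j (row_len mu i')) => //= mj'.
  rewrite ltnNge (leq_trans (row_len_leq mu ii) mj') /=.
  move=> /existsP[c /and3P[/eqP ci /eqP cj T0]] jl.
  have [d [di dj]] := mkbox mj' (leq_trans jl (row_len_leq la ii)).
  apply/existsP; exists d; rewrite di dj !eqxx /=.
  have : T d <= T c by apply: Tc; rewrite ?di ?ci //; apply: val_inj; rewrite /= dj cj.
  by rewrite (eqP T0) leqn0.
pose nu := of_cols [seq count (Q^~ j) (iota 0 (size la)) | j <- iota 0 (row_len la 0)].
have nuE i j : (j < row_len nu i) = Q i j.
  have E j0 : (i < count (Q^~ j0) (iota 0 (size la))) = Q i j0.
    rewrite count_downset; last by move=> ? ?; apply: Qcol.
    by apply/andb_idl => /Qla jl; rewrite -row_len_gt0 (leq_ltn_trans _ jl).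
  rewrite row_len_of_cols count_map (eq_count (a2 := Q i)) => [|j0]; last by rewrite /= E.
  rewrite count_downset; last by move=> ? ?; apply: Qrow.
  by apply/andb_idl => /Qla jl; apply: leq_trans jl (row_len_leq la _).
have mn : psub mu nu by apply/psubP/part_sub_ltn => i j jm; rewrite nuE /Q jm.
have nl : psub nu la by apply/psubP/part_sub_ltn => i j; rewrite nuE; apply: Qla.
exists nu; split=> //.
(* Entries outside [nu] are positive, so the predecessor undoes the shift; a box of [la / nu] is one
   of [la / mu], so the default 0 is never reached. *)
exists [ffun c : box la nu => if insub (val c) is Some c' then (T c').-1 else 0].
apply/ffunP => c; have [lt|ge] := ltnP (bcol c) (row_len nu (brow c)).
  transitivity 0; last by apply/esym/eqP; rewrite lift_eq0.
  move: lt; rewrite nuE /Q ltnNge; case/andP: (box_bounds c) => -> _ /=.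
  by case/existsP => d /and3P[/eqP/val_inj dr /eqP/val_inj dc /eqP];
    rewrite (box_inj dr dc).
have [c' cE] := box_sub ge; rewrite (lift_val _ cE) ffunE cE valK prednK //.
rewrite lt0n; apply: contraTN ge => T0; rewrite -ltnNge nuE.
by apply/orP; right; apply/existsP; exists c; rewrite !eqxx.
Qed.

(** Quantifying over all [i], with default 0 past the end of [s], also says that no letter beyond
    the list occurs. *)
Definition content_list mu (T : filling la mu) (s : seq nat) := forall i, nth 0 s i =
  ncols T i.

Lemma rpp_list s mu : psub mu la -> exists L : seq (filling la mu),
  [/\ uniq L, forall T, T \in L <-> is_rpp T /\ content_list T s & size L = nchain mu la s].
Proof.
elim: s mu => [|p s IHs] mu ml.
  exists (if mu == la then [:: [ffun=> 0]] else [::]).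
  split; [by case: ifP| |by case: ifP => /= ->].
  move=> T; case: eqP => [E|ne].
    have nobox (c : box la mu) : False.
      have /andP[a b] := box_bounds c; have := leq_ltn_trans a b.
      by rewrite (congr1 (row_len^~ (brow c)) E) ltnn.
    rewrite inE; split=> [_|_]; last by apply/eqP/ffunP => c; case: (nobox c).
    split; first by split=> c; case: (nobox c).
    move=> i; rewrite nth_nil; apply/esym/eqP; rewrite cards_eq0; apply/eqP/setP => j.
    by rewrite !inE; apply/existsP => -[c]; case: (nobox c).
  split=> // -[_ T0]; case: ne; apply: psub_anti => //.
  apply/psubP/part_sub_ltn => i j jl; rewrite ltnNge; apply/negP => mj.
  have [c _] := mkbox mj jl.
  have /eqP := T0 (T c); rewrite nth_nil eq_sym cards_eq0 => /eqP/setP/(_ (bcol c)).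
  by rewrite !inE => /existsP; case; exists c; rewrite !eqxx.
(* The induction hypothesis gives mere existence, and only for [nu] inside [la]; one list per shape
   is chosen so that the lists can be concatenated. *)
pose Lf nu : seq (filling la nu) :=
  if pselect (psub nu la) is left nl then sval (cid (IHs nu nl)) else [::].
have LfP nu : psub nu la -> [/\ uniq (Lf nu),
    forall T, T \in Lf nu <-> is_rpp T /\ content_list T s & size (Lf nu) = nchain nu la s].
  by rewrite /Lf; case: pselect => // nl _; apply: (svalP (cid (IHs nu nl))).
pose N := [seq nu <- between mu la | cdiff mu nu == p].
exists [seq lift_filling mu T | nu <- N, T <- Lf nu]; split.
- apply: allpairs_uniq_dep; first by rewrite filter_uniq ?uniq_between.
    by move=> nu; rewrite mem_filter mem_between => /and3P[_ _ /LfP[]].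
  move=> [nu T] [nu' T'] /allpairsPdep[? [? [nN _ E1]]] /allpairsPdep[? [? [nN' _ E2]]] /=.
  move/(congr1 (@tag _ _)): E1 => /= E1; move/(congr1 (@tag _ _)): E2 => /= E2; subst.
  move: nN nN'; rewrite !mem_filter !mem_between => /and3P[_ mn nl] /and3P[_ mn' nl'] E.
  have En := lift_shape mn mn' nl nl' E; subst.
  by rewrite (lift_inj mn E).
- move=> T; split=> [/allpairsPdep[nu [T' [nN TL ->]]]|[Trpp Tcont]].
    move: nN; rewrite mem_filter mem_between => /and3P[/eqP cd mn nl].
    have [_ LP _] := LfP nu nl; have [T'rpp T'c] := (LP T').1 TL.
    split; first exact/lift_is_rpp.
    by move=> [|i] /=; rewrite ?ncols_lift0 ?ncols_liftS.
  have [nu [mn nl [T' TE]]] := unlift ml Trpp.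
  have [_ LP _] := LfP nu nl.
  rewrite TE; apply: allpairs_f_dep.
    by rewrite mem_filter mem_between mn nl !andbT -(ncols_lift0 T') // -TE -Tcont.
  apply/LP; split; first by apply/(lift_is_rpp T' mn); rewrite -TE.
  by move=> i; rewrite -(ncols_liftS T' i mn) -TE -Tcont.
rewrite size_allpairs_dep sumnE big_map big_filter /=.
rewrite big_seq_cond [RHS]big_seq_cond; apply: eq_bigr => nu.
by rewrite mem_between => /andP[/andP[_ /LfP[]]].
Qed.

End Boxes.

(** * Coefficients of the dual Grothendieck and Schur functions *)

Section SchurContent.
Local Open Scope nat_scope.
Variables la mu : intpart.
Implicit Types T : filling la mu.

Lemma ncols_imset T i : ncols T i = #|(@bcol la mu @: [set c | T c == i])%SET|.
Proof.
apply: eq_card => j; rewrite inE; apply/existsP/imsetP => [[c /andP[/eqP <- Tc]]|[c]].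
  by exists c; rewrite ?inE.
by rewrite inE => Tc ->; exists c; rewrite eqxx Tc.
Qed.

Lemma ncols_leq T i : ncols T i <= nboxes T i.
Proof. by rewrite ncols_imset; apply: leq_imset_card. Qed.

Lemma sum_nboxes T N : (forall c, T c < N) ->
  \sum_(0 <= i < N) nboxes T i = #|{: box la mu}|.
Proof.
move=> TN; transitivity (\sum_(0 <= i < N) \sum_(c : box la mu) (T c == i)).
  by apply: eq_bigr => i _; rewrite /nboxes cardsE -sum1_card big_mkcond.
rewrite exchange_big /= -sum1_card; apply: eq_bigr => c _.
rewrite (bigD1_seq (T c)) ?mem_index_iota ?iota_uniq //= eqxx big1 // => i.
by rewrite eq_sym => /negbTE ->.
Qed.

Lemma is_ssyt_rpp T : is_ssyt T -> is_rpp T.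
Proof.
move=> [Tr Tc]; split=> // c d E;
  rewrite leq_eqVlt => /orP[/eqP/val_inj r|/(Tc _ _ E)/ltnW //].
by rewrite (box_inj r E).
Qed.

Lemma is_ssyt_ncols T i : is_ssyt T -> ncols T i = nboxes T i.
Proof.
move=> [Tr Tc]; rewrite ncols_imset; apply: card_in_imset => c d; rewrite !inE.
move=> /eqP Tci /eqP Tdi E; apply: box_inj => //; apply: val_inj; apply/eqP.
rewrite eqn_leq /=; apply/andP; split; rewrite leqNgt; apply/negP => /Tc.
  by rewrite Tci Tdi ltnn E => /(_ erefl).
by rewrite Tci Tdi ltnn E => /(_ erefl).
Qed.

Lemma sumn_nth_wide (s : seq nat) N : size s <= N -> sumn s = \sum_(0 <= i < N) nth 0 s i.
Proof. by move=> sN; rewrite -sumn_take_nth take_oversize. Qed.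

Lemma filling_bound T (s : seq nat) : exists N, size s <= N /\ forall c, T c < N.
Proof.
exists (maxn (size s) (\max_(c : box la mu) T c).+1); split; first exact: leq_maxl.
by move=> c; rewrite leq_max ltnS (leq_bigmax c) orbT.
Qed.

(* Reading by columns loses no entry exactly when the columns are strict. *)
Lemma ssyt_contentP T s : is_ssyt T /\ (forall i, nth 0 s i = nboxes T i) <->
  [/\ is_rpp T, content_list T s & sumn s = #|{: box la mu}|].
Proof.
have [N [sN TN]] := filling_bound T s.
split=> [[Ts Tc]|[Trpp Tc sE]].
  split; first exact: is_ssyt_rpp; first by move=> i; rewrite Tc is_ssyt_ncols.
  by rewrite -(sum_nboxes TN) (sumn_nth_wide sN); apply: eq_bigr => i _.
have cE i : ncols T i = nboxes T i.
  have [iN|Ni] := ltnP i N; last first.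
    apply/eqP; rewrite eqn_leq ncols_leq /= [X in X <= _](_ : _ = 0) //.
    apply/eqP; rewrite cards_eq0; apply/eqP/setP => c; rewrite !inE.
    by apply/negbTE; rewrite neq_ltn (leq_trans (TN c) Ni).
  apply: (leq_sum_eq (n := N)) => //; first exact: ncols_leq.
  rewrite (sum_nboxes TN) -sE (sumn_nth_wide sN).
  by apply: eq_bigr => j _; rewrite Tc.
split; last by move=> i; rewrite Tc cE.
have [Tr Tcol] := Trpp; split=> // c d E lt.
rewrite ltn_neqAle (Tcol _ _ E (ltnW lt)) andbT; apply/eqP => Tcd.
have := cE (T d); rewrite ncols_imset => /eqP/imset_injP/(_ c d).
by rewrite !inE Tcd eqxx => /(_ isT isT E) cd; rewrite cd ltnn in lt.
Qed.

End SchurContent.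

Lemma card_box la : #|{: box la emptyp}| = sumn la.
Proof.
rewrite card_sig (@sumn_rows la (size la)) // big_mkord.
rewrite -sum1_card (eq_bigl (fun c : 'I_(size la) * 'I_(row_len la 0) =>
   xpredT c.1 && (c.2 < row_len la c.1)%N)); last first.
  by move=> c; rewrite inE row_emptyp.
rewrite -(pair_big_dep xpredT (fun (i : 'I_(size la)) (j : 'I_(row_len la 0)) =>
   (j < row_len la i)%N) (fun _ _ => 1%N)) /=.
apply: eq_bigr => i _.
rewrite -[RHS](@sum_ltn _ (row_len la 0)) ?row_len_leq //.
by rewrite big_mkord big_mkcond; apply: eq_bigr => j _; case: ifP.
Qed.

Section Values.
Variable K : comPzRingType.

Lemma sum1_list (T : choiceType) (L : seq T) (A : set T) : uniq L ->
  (forall x, x \in L <-> A x) -> \sum_(x \in A) (1 : K) = (size L)%:R.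
Proof.
move=> uL LA; have -> : A = [set` L] by apply/seteqP; split=> x /LA.
by rewrite -fsbig_seq // big_const_seq count_predT iter_addr_0.
Qed.

Lemma g_series_content la mu s (m : monom) : psub mu la ->
  (forall i, m i = nth 0%N s i) -> g_series K la mu m = (nchain mu la s)%:R.
Proof.
move=> ml ms; have [L [uL LP sL]] := rpp_list s ml.
rewrite /g_series /= (sum1_list uL) ?sL // => T; rewrite LP.
by split=> -[Trpp Tc]; split=> // i; [rewrite ms|rewrite -ms]; apply: Tc.
Qed.

Lemma schur_content la s (m : monom) : (forall i, m i = nth 0%N s i) ->
  schur K la m = if sumn s == sumn la then (nchain emptyp la s)%:R else 0.
Proof.
move=> ms; have [L [uL LP sL]] := rpp_list s (psub0 la).
have SP (T : filling la emptyp) : is_ssyt T /\ (forall i, m i = nboxes T i) <->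
    [/\ is_rpp T, content_list T s & sumn s = sumn la].
  have := ssyt_contentP T s; rewrite card_box => <-.
  by split=> -[Ts Tc]; split=> // i; [rewrite -ms|rewrite ms]; apply: Tc.
rewrite /schur /=; case: eqP => [sE|ne].
  rewrite (sum1_list uL) ?sL // => T; rewrite LP; split=> [[? ?]|/SP[? ?] //].
  exact/SP.
by apply: fsbig1 => T /SP[].
Qed.

(** * Monomials as exponent lists, and symmetry as invariance under permutations *)

Definition mon (s : seq nat) : monom :=
  mkcmonom [fsfun i in [fset i in iota 0 (size s)]%fset => nth 0%N s i | 0%N].

Lemma monE s i : mon s i = nth 0%N s i.
Proof.
rewrite /mon cmE fsfun_fun !inE mem_iota add0n /=.
by case: ltnP => // si; rewrite nth_default.
Qed.

Lemma mon_eq s (m : monom) : (forall i, m i = nth 0%N s i) -> m = mon s.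
Proof. by move=> ms; apply/eqP/cmP => i; rewrite ms monE. Qed.

Lemma monom_bound (m : monom) : exists N, forall i, (N <= i)%N -> m i = 0%N.
Proof.
exists (\max_(i <- finsupp m) i).+1 => i Ni; apply/eqP; rewrite cmE_eq0.
apply/negP => im; have : (i <= \max_(i <- finsupp m) i)%N by apply: leq_bigmax_seq.
by rewrite leqNgt Ni.
Qed.

Lemma monom_mon (m : monom) N : (forall i, (N <= i)%N -> m i = 0%N) -> m = mon (mkseq m N).
Proof.
move=> mN; apply: mon_eq => i; have [iN|Ni] := ltnP i N; first by rewrite nth_mkseq.
by rewrite nth_default ?size_mkseq // mN.
Qed.

Lemma mdeg_mon s : mdeg (mon s) = sumn s.
Proof.
rewrite (mdegEw (d := [fset i in iota 0 (size s)]%fset)); last first.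
  apply/fsubsetP => i; rewrite -cmE_neq0 monE !inE mem_iota add0n /=.
  by case: ltnP => // si; rewrite nth_default.
rewrite (sumn_nth_wide (leqnn _)) /index_iota subn0.
rewrite (perm_big (iota 0 (size s))) /=; last first.
  by apply: uniq_perm; rewrite ?fset_uniq ?iota_uniq // => i; rewrite !inE.
by apply: eq_bigr => i _; rewrite monE.
Qed.

Lemma sym_series_perm (f : series K) s t : sym_series f -> perm_eq s t ->
  f (mon s) = f (mon t).
Proof.
move=> fs /(perm_iotaP 0%N)[Is pI sE].
pose n := size t; have sI : size Is = n by rewrite (perm_size pI) size_iota.
have uI : uniq Is by rewrite (perm_uniq pI) iota_uniq.
have mI i : (i \in Is) = (i < n)%N by rewrite (perm_mem pI) mem_iota.
(* The permutation of positions is extended by the identity to a bijection of nat. *)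
pose u i := if (i < n)%N then nth 0%N Is i else i.
pose v i := if (i < n)%N then index i Is else i.
apply: (fs u).
  exists v => i; rewrite /u /v; case: (ltnP i n) => lt; try by rewrite ltnNge lt.
    by rewrite -mI mem_nth ?sI // index_uniq ?sI.
  by rewrite -{1}sI index_mem mI lt nth_index // mI.
move=> i; rewrite !monE sE /u; case: ltnP => [il|li].
  by rewrite (nth_map 0%N) ?sI.
by rewrite !nth_default // size_map sI.
Qed.

Lemma perm_nonzero (s t : seq nat) : size s = size t ->
  perm_eq [seq x <- s | x != 0%N] [seq x <- t | x != 0%N] -> perm_eq s t.
Proof.
move=> st nz; have zeros (r : seq nat) : [seq x <- r | ~~ (x != 0%N)] =
    nseq (size r - size [seq x <- r | x != 0%N]) 0%N.
  rewrite size_filter -(count_predC (fun x => x != 0%N) r) addKn -size_filter.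
  by apply/all_pred1P; rewrite all_filter; apply/allP => x _; apply/implyP;
    rewrite /= negbK.
rewrite -(perm_filterC (fun x => x != 0%N) s) perm_sym.
rewrite -(perm_filterC (fun x => x != 0%N) t) perm_sym.
by apply: perm_cat => //; rewrite !zeros st (perm_size nz).
Qed.

(** A bijection of nat need not preserve the range below [N], but it matches the nonzero exponents
    of the two monomials, and lists of equal length with the same nonzero entries are permutations
    of each other. *)
Lemma perm_sym_seriesP (f : series K) :
  (forall s t, perm_eq s t -> f (mon s) = f (mon t)) -> sym_series f.
Proof.
move=> fp u m m' [v uK vK] mE.
have [N1 m1] := monom_bound m; have [N2 m2] := monom_bound m'.
pose N := maxn N1 N2.
have mN i : (N <= i)%N -> m i = 0%N by rewrite geq_max => /andP[/m1].
have m'N i : (N <= i)%N -> m' i = 0%N by rewrite geq_max => /andP[_ /m2].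
rewrite (monom_mon mN) (monom_mon m'N); apply/fp/perm_nonzero; first by rewrite !size_mkseq.
rewrite /mkseq (eq_map mE) map_comp !filter_map.
rewrite -[X in perm_eq (map m X)]filter_map.
apply: perm_map; apply: uniq_perm; rewrite ?filter_uniq ?iota_uniq //.
  by rewrite map_inj_uniq ?iota_uniq //; apply: can_inj uK.
move=> i; rewrite !mem_filter /=; case: eqP => //= mi.
have iN : (i < N)%N by rewrite ltnNge; apply/negP => /mN.
rewrite mem_iota iN -[i in LHS]vK mem_map; last exact: can_inj uK.
rewrite mem_iota /= ltnNge; apply/negP => /m'N; rewrite mE vK //.
Qed.

Lemma monom_part (m : monom) : exists la : intpart, mdeg m = sumn la /\
  forall f : series K, sym_series f -> f m = f (mon la).
Proof.
have [N mN] := monom_bound m; pose s := mkseq m N.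
pose h := sort geq [seq x <- s | x != 0%N].
have hP : is_intpart h.
  rewrite /is_intpart sort_sorted; last by move=> x y; apply: leq_total.
  by rewrite mem_sort mem_filter eqxx.
pose k := (size s - size h)%N.
have sh : perm_eq s (h ++ nseq k 0%N).
  apply: perm_nonzero.
    rewrite size_cat size_nseq /k subnKC // size_sort size_filter; exact: count_size.
  rewrite filter_cat [X in _ ++ X](_ : _ = [::]); last by elim: (k).
  rewrite cats0 /h [X in perm_eq _ X](_ : _ = h); last first.
    by apply/all_filterP; rewrite all_sort; apply: filter_all.
  by rewrite perm_sym perm_sort.
have E : mon (h ++ nseq k 0%N) = mon h.
  apply/mon_eq => i; rewrite monE nth_cat; case: ltnP => // hi.
  by rewrite nth_nseq if_same nth_default.
exists (IntPart hP); split; last first.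
  by move=> f fs; rewrite (monom_mon mN) (sym_series_perm fs sh) E.
by rewrite (monom_mon mN) mdeg_mon (perm_sumn sh) -(mdeg_mon (_ ++ _)) E mdeg_mon.
Qed.

Lemma hat_sym (F : LambdaHat K) : sym_series F.
Proof. by have /asboolP := hat_seriesP F. Qed.

Lemma hat_ext (F G : LambdaHat K) : (forall la : intpart, F (mon la) = G (mon la)) -> F = G.
Proof.
move=> FG; apply: val_inj; apply: seriesP => m; have [la [_ H]] := monom_part m.
by rewrite !H //; exact: hat_sym.
Qed.

Lemma lambda_ext (f g : Lambda K) : (forall la : intpart, f (mon la) = g (mon la)) -> f = g.
Proof. by move=> fg; apply: val_inj; apply: hat_ext. Qed.

Lemma g_series_sym la mu : psub mu la -> g_series K la mu \in @Defs.is_sym K.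
Proof.
move=> ml; apply/asboolP/perm_sym_seriesP => s t st.
by rewrite !(g_series_content ml (monE _)) (nchain_perm _ _ st).
Qed.

Lemma schur_sym la : schur K la \in @Defs.is_sym K.
Proof.
apply/asboolP/perm_sym_seriesP => s t st.
by rewrite !(schur_content _ (monE _)) (nchain_perm _ _ st) (perm_sumn st).
Qed.

Lemma g_series_bounded (la mu : intpart) (m : monom) : psub mu la ->
  (sumn la < mdeg m)%N -> g_series K la mu m = 0.
Proof.
move=> ml; have [N mN] := monom_bound m; rewrite {1 2}(monom_mon mN) mdeg_mon => lt.
rewrite (g_series_content ml (monE _)) (_ : nchain _ _ _ = 0%N) //; apply/eqP.
apply: contraTT lt => /nchain_sumn; rewrite -leqNgt; apply: leq_trans.
exact: leq_addl.
Qed.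

Lemma schur_degree (la : intpart) (m : monom) : mdeg m != sumn la -> schur K la m = 0.
Proof.
have [N mN] := monom_bound m; rewrite {1 2}(monom_mon mN) mdeg_mon => ne.
by rewrite (schur_content _ (monE _)) (negbTE ne).
Qed.

Definition schur_hat la : LambdaHat K := MkLambdaHat (schur_sym la).

Lemma schur_hat_bounded la : schur_hat la \in @is_bounded K.
Proof. by apply/asboolP; exists (sumn la) => m lt; apply: schur_degree;
  rewrite gtn_eqF. Qed.

Definition schurL la : Lambda K := MkLambda (schur_hat_bounded la).

Lemma gskewE la mu : psub mu la -> (gskew K la mu : series K) = g_series K la mu.
Proof.
move=> ml; rewrite /gskew.
have E : (insubd (0 : LambdaHat K) (g_series K la mu) : series K) = g_series K la mu.
  by apply: (insubdK (0 : LambdaHat K)); apply: g_series_sym.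
rewrite -[RHS]E; congr (hat_series _); apply: (insubdK (0 : Lambda K)).
by apply/asboolP; exists (sumn la) => m lt; rewrite E g_series_bounded.
Qed.

Lemma gskew_mon la mu s : psub mu la -> gskew K la mu (mon s) = (nchain mu la s)%:R.
Proof. by move=> ml; rewrite gskewE // (g_series_content ml (monE s)). Qed.

Lemma gskew_degree (la mu : intpart) (m : monom) : psub mu la ->
  (sumn la < mdeg m)%N -> gskew K la mu m = 0.
Proof. by move=> ml; rewrite gskewE //; apply: g_series_bounded. Qed.

Lemma schurL_mon la s : schurL la (mon s) =
  if sumn s == sumn la then (nchain emptyp la s)%:R else 0.
Proof. exact: schur_content (monE s). Qed.

End Values.

(** * Bases, the Hall pairing and the dual family *)

(** A partition of size at most [n] fits in the [n] by [n] square, so the enumeration of shapes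
    between two given ones serves again. *)
Definition allp (n : nat) : seq intpart :=
  [seq la <- between emptyp (of_cols (nseq n n)) | sumn (la : intpart) <= n]%N.

Lemma mem_allp n (la : intpart) : (la \in allp n) = (sumn la <= n)%N.
Proof.
rewrite mem_filter; apply/andb_idr => lan; rewrite mem_between /=.
apply/psubP/part_sub_ltn => i j jl; rewrite row_len_of_cols count_nseq.
have il : (i < size la)%N by rewrite -row_len_gt0 (leq_ltn_trans _ jl).
rewrite (leq_trans il) ?(leq_trans (size_sumn la)) // mul1n.
by rewrite (leq_trans jl) // (leq_trans (row_len_leq la (leq0n i))) // (leq_trans
  (row_len_sumn la)).
Qed.

Lemma allp_uniq n : uniq (allp n).
Proof. by rewrite filter_uniq ?uniq_between. Qed.

(** Thanks to the cube in [prank], the sizes up to [d] form an initial segment for the rank: a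
    degree bound is a rank bound, and inductions can run on the rank alone. *)
Lemma prank_ltn (la : intpart) d : (prank la < d.+1 ^ 3)%N = (sumn la <= d)%N.
Proof.
rewrite /prank; apply/idP/idP => [lt|le].
  rewrite -ltnS -(@ltn_exp2r _ _ 3) //; apply: leq_ltn_trans lt; exact: leq_addr.
have bd : (\sum_(0 <= j < sumn la) sumn (take j la) <= sumn la * sumn la)%N.
  apply: leq_trans (leq_sum _ (fun j _ => sumn_take_leq la j)) _.
  by rewrite sum_nat_const_nat subn0.
have {}le : ((sumn la).+1 ^ 3 <= d.+1 ^ 3)%N by rewrite leq_exp2r.
apply: leq_trans le; move: bd; set x := sumn la; set y := (\sum_(_ <= _ < _) _)%N; nia.
Qed.

Section Bases.
Variable K : comPzRingType.
Implicit Types (f g : Lambda K) (F G : LambdaHat K).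

Lemma hatD F G m : (F + G) m = F m + G m. Proof. by []. Qed.
Lemma hatZ a F m : (a *: F) m = a * F m. Proof. by []. Qed.
Lemma lamD f g m : (f + g) m = f m + g m. Proof. by []. Qed.
Lemma lamB f g m : (f - g) m = f m - g m. Proof. by []. Qed.
Lemma lamZ a f m : (a *: f) m = a * f m. Proof. by []. Qed.
Lemma lam_sum (I : Type) (r : seq I) (P : pred I) (f : I -> Lambda K) m :
  (\sum_(i <- r | P i) f i) m = \sum_(i <- r | P i) f i m.
Proof. exact: (big_morph (fun f : Lambda K => f m) (id1 := 0)). Qed.

Definition deg_le f d := forall m : monom, (d < mdeg m)%N -> f m = 0.

Lemma deg_le_exists f : exists d, deg_le f d.
Proof. by have /asboolP := lambda_hatP f. Qed.

Lemma deg_leW f d e : (d <= e)%N -> deg_le f d -> deg_le f e.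
Proof. by move=> de fd m em; apply: fd; apply: leq_ltn_trans em. Qed.

Definition triangular (B : intpart -> Lambda K) := forall la,
  B la (mon la) = 1 /\ forall mu : intpart, B la (mon mu) != 0 ->
    mu = la \/ (prank mu < prank la)%N.

Lemma triangular_schurL : triangular (@schurL K).
Proof.
move=> la; split; first by rewrite schurL_mon eqxx nchain_diag.
move=> mu; rewrite schurL_mon; case: ifP => _; last by rewrite eqxx.
by move=> nz; apply: nchain_tri; apply: contraNneq nz => ->.
Qed.

Lemma triangular_gdual : triangular (gdual K).
Proof.
move=> la; split; first by rewrite gskew_mon ?psub0 // nchain_diag.
move=> mu; rewrite gskew_mon ?psub0 // => nz.
by apply: nchain_tri; apply: contraNneq nz => ->.
Qed.

Lemma triangular_deg B (la : intpart) : triangular B -> deg_le (B la) (sumn la).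
Proof.
move=> /(_ la)[_ T] m; have [mu [mE H]] := monom_part K m.
rewrite mE => lt; rewrite H; last exact: hat_sym.
apply/eqP; apply: contraTT lt => /T; rewrite -leqNgt => -[->//|].
by apply: contraTT; rewrite -ltnNge -leqNgt => /prank_sumn/ltnW.
Qed.

Lemma triangular_span B d n f : triangular B -> (n <= d.+1 ^ 3)%N ->
  (forall mu : intpart, (n <= prank mu)%N -> f (mon mu) = 0) ->
  exists e : intpart -> K, (forall la, (n <= prank la)%N -> e la = 0) /\
    f = \sum_(la <- allp d) e la *: B la.
Proof.
move=> T; elim: n f => [|n IHn] f nd fn.
  exists (fun=> 0); split=> //; rewrite big1 => [|la _]; last by rewrite scale0r.
  by apply: lambda_ext => la; rewrite fn.
(* A nonzero coefficient off the diagonal needs strictly smaller rank, so distinct partitions of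
   rank [n] do not interact and all coefficients of [f] at this rank can be removed at once. *)
pose e1 la := if prank la == n then f (mon la) else 0.
pose f1 := \sum_(la <- allp d) e1 la *: B la.
have f1E (mu : intpart) : (n <= prank mu)%N -> f1 (mon mu) = f (mon mu).
  rewrite leq_eqVlt => /orP[/eqP mun|nmu].
    have mud : mu \in allp d by rewrite mem_allp -prank_ltn -mun.
    rewrite lam_sum (bigD1_seq mu) ?allp_uniq //= ?lamZ /e1 -mun eqxx (T mu).1 mulr1.
    rewrite big1 ?addr0 // => la /eqP ne; rewrite ?lamZ; case: eqP => [lan|];
      last by rewrite mul0r.
    have [->|/(T la).2[/esym //|]] := eqVneq (B la (mon mu)) 0; first by rewrite mulr0.
    by rewrite lan -mun ltnn.
  rewrite fn // lam_sum big1 // => la _; rewrite ?lamZ /e1; case: eqP => [lan|];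
    last by rewrite mul0r.
  have [->|/(T la).2[E|]] := eqVneq (B la (mon mu)) 0; first by rewrite mulr0.
    by rewrite E lan ltnn in nmu.
  by rewrite lan ltnNge ltnW.
have [||e [e0 eE]] := IHn (f - f1); first exact: ltnW.
  by move=> mu nmu; rewrite lamB f1E // subrr.
exists (fun la => e la + e1 la); split=> [la nla|].
  by rewrite e0 1?ltnW // /e1 gtn_eqF // addr0.
rewrite -[LHS](subrK f1) eE -big_split /=; apply: eq_bigr => la _.
by rewrite scalerDl.
Qed.

(** Descending induction on the rank, with [k] the allowed distance below the cube of [d + 1]: the
    coefficient at [mon la] involves only [e la] and coefficients of larger rank, already known to
    vanish. *)
Lemma triangular_free B d (e : intpart -> K) : triangular B ->
  \sum_(la <- allp d) e la *: B la = 0 -> forall la : intpart, (sumn la <= d)%N -> e la = 0.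
Proof.
move=> T E; suff H k (la : intpart) : (sumn la <= d)%N ->
  (d.+1 ^ 3 <= prank la + k)%N -> e la = 0.
  by move=> la lad; apply: (H (d.+1 ^ 3)%N) => //; apply: leq_addl.
elim: k la => [|k IHk] la lad; first by rewrite addn0 leqNgt prank_ltn lad.
move=> kla; have : (\sum_(la <- allp d) e la *: B la : Lambda K) (mon la) = 0 by rewrite E.
rewrite lam_sum (bigD1_seq la) ?allp_uniq ?mem_allp //= ?lamZ (T la).1 mulr1.
rewrite big1_seq ?addr0 // => mu /andP[ne]; rewrite mem_allp ?lamZ => mud.
have [->|/(T mu).2[lamu|lt]] := eqVneq (B mu (mon la)) 0; first by rewrite mulr0.
  by rewrite lamu eqxx in ne.
by rewrite (IHk mu) ?mul0r // (leq_trans kla) // addnS -addSn leq_add2r.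
Qed.

Lemma triangular_basis B d f : triangular B -> deg_le f d ->
  exists e : intpart -> K, (forall la : intpart, (d < sumn la)%N -> e la = 0) /\
    f = \sum_(la <- allp d) e la *: B la.
Proof.
move=> T fd; have [la|e [e0 eE]] := @triangular_span B d (d.+1 ^ 3) f T (leqnn _).
  by rewrite leqNgt prank_ltn -ltnNge => lt; apply: fd; rewrite mdeg_mon.
by exists e; split=> // la lt; apply: e0; rewrite leqNgt prank_ltn -ltnNge.
Qed.

Lemma allp_widen (V : nmodType) (H : intpart -> V) d n : (d <= n)%N ->
  (forall la : intpart, (d < sumn la)%N -> H la = 0) ->
  \sum_(la <- allp d) H la = \sum_(la <- allp n) H la.
Proof.
move=> dn H0; rewrite [RHS](bigID (fun la : intpart => (sumn la <= d)%N)) /=.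
rewrite [X in _ + X]big1 ?addr0 => [|la]; last by rewrite -ltnNge; apply: H0.
rewrite -[RHS]big_filter; apply: perm_big; apply: uniq_perm;
  rewrite ?allp_uniq ?(filter_uniq _ (allp_uniq _)) //.
by move=> la; rewrite [in RHS]mem_filter !mem_allp; case: leqP => // /leq_trans ->.
Qed.

Lemma fsum_allp (V : nmodType) (H : intpart -> V) d :
  (forall la : intpart, (d < sumn la)%N -> H la = 0) ->
  \sum_(la \in [set: intpart]) H la = \sum_(la <- allp d) H la.
Proof.
move=> H0; rewrite (fsbigE (allp d)) ?allp_uniq //.
  by apply: eq_bigl => la; rewrite in_setT.
by move=> la _; rewrite mem_allp -ltnNge; apply: H0.
Qed.

(** * Schur expansion in the completion and the Hall pairing *)

Fact homog_subproof F d : Series (fun m => if mdeg m == d then F m else 0) \in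
  @Defs.is_sym K.
Proof.
apply/asboolP => s m m' bs mE /=; rewrite (permmon_mdeg bs mE).
by case: eqP => // _; apply: hat_sym mE.
Qed.
Definition homog_hat F d : LambdaHat K := MkLambdaHat (homog_subproof F d).
Fact homog_bounded F d : homog_hat F d \in @is_bounded K.
Proof. by apply/asboolP; exists d => m lt /=; rewrite gtn_eqF. Qed.
Definition homog F d : Lambda K := MkLambda (homog_bounded F d).

Lemma fsum_schur (a : intpart -> K) m :
  \sum_(la \in [set: intpart]) a la * schur K la m = \sum_(la <- allp (mdeg m)) a la *
    schur K la m.
Proof.
by apply: fsum_allp => la lt; rewrite schur_degree ?mulr0 // ltn_eqF.
Qed.

Lemma schurLE la m : schurL K la m = schur K la m. Proof. by []. Qed.

(** An element of the completion has no degree bound, so each homogeneous part is expanded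
    separately. Schur functions being homogeneous, the coefficient of [s_la] is taken from the part
    of degree [sumn la]. *)
Lemma schur_expand F : exists a : intpart -> K,
  forall m, F m = \sum_(la <- allp (mdeg m)) a la * schur K la m.
Proof.
have H d : {e : intpart -> K | homog F d = \sum_(la <- allp d) e la *: schurL K la}.
  apply: cid; have [|e [_ eE]] := @triangular_basis _ d (homog F d) triangular_schurL.
    by move=> m lt /=; rewrite gtn_eqF.
  by exists e.
exists (fun la : intpart => sval (H (sumn la)) la) => m.
have E : F m = homog F (mdeg m) m by rewrite /= eqxx.
rewrite E {1}(svalP (H (mdeg m))) lam_sum; apply: eq_bigr => la _; rewrite lamZ schurLE.
have [->//|ne] := eqVneq (sumn la) (mdeg m).
by rewrite schur_degree ?mulr0 // eq_sym.
Qed.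

Lemma schur_expand_uniq (a b : intpart -> K) :
  (forall m, \sum_(la <- allp (mdeg m)) a la * schur K la m =
             \sum_(la <- allp (mdeg m)) b la * schur K la m) -> a = b.
Proof.
move=> E; apply: funext => la; apply/eqP; rewrite -subr_eq0; apply/eqP.
(* Restricting the difference to partitions of one size leaves a finite combination in Lambda, to
   which [triangular_free] applies. *)
pose c (mu : intpart) := if sumn (mu : intpart) == sumn la then a mu - b mu else 0.
suff /(_ la (leqnn _)) : forall mu : intpart, (sumn mu <= sumn la)%N ->
  c mu = 0 by rewrite /c eqxx.
apply: triangular_free triangular_schurL _; apply: lambda_ext => mu.
rewrite lam_sum; change ((0 : Lambda K) (mon mu)) with (0 : K).
have [muE|ne] := eqVneq (sumn mu) (sumn la); last first.
  rewrite big1 // => ka _; rewrite ?lamZ /c; case: eqP => [kE|]; last by rewrite mul0r.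
  by rewrite schurL_mon kE (negbTE ne) mulr0.
have := E (mon mu); rewrite mdeg_mon muE => /eqP; rewrite -subr_eq0 -sumrB => /eqP E0.
rewrite -[RHS]E0; apply: eq_bigr => ka _; rewrite ?lamZ /c -mulrBl.
case: eqP => // kE; rewrite mul0r schur_degree ?mulr0 // mdeg_mon muE eq_sym.
exact/eqP.
Qed.

Lemma schur_coefP F m : F m = \sum_(la <- allp (mdeg m)) schur_coef F la * schur K la m.
Proof.
have [a aE] := schur_expand F; rewrite -fsum_schur /schur_coef.
case: xgetP => [b -> //|/(_ a)]; case=> m'.
by rewrite fsum_schur.
Qed.

Lemma schur_coef_uniq F (a : intpart -> K) :
  (forall m, F m = \sum_(la <- allp (mdeg m)) a la * schur K la m) -> schur_coef F = a.
Proof. by move=> H; apply: schur_expand_uniq => m; rewrite -schur_coefP. Qed.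

Lemma schur_coefL a F G la : schur_coef (a *: F + G) la = a * schur_coef F la +
  schur_coef G la.
Proof.
have -> // : schur_coef (a *: F + G) = fun la => a * schur_coef F la + schur_coef G la.
apply: schur_coef_uniq => m; rewrite hatD hatZ (schur_coefP F) (schur_coefP G).
rewrite mulr_sumr -big_split /=; apply: eq_bigr => ka _.
by rewrite mulrDl mulrA.
Qed.

Lemma schur_coef_schur (la mu : intpart) : schur_coef (schurL K la) mu = (la == mu)%:R.
Proof.
suff -> : schur_coef (schurL K la) = fun mu => (la == mu)%:R by [].
apply: schur_coef_uniq => m; have [E|ne] := eqVneq (mdeg m) (sumn la).
  rewrite (bigD1_seq la) ?allp_uniq ?mem_allp ?E // eqxx mul1r big1 => [|ka /=];
    first exact/esym/addr0.
  by rewrite eq_sym => /negbTE ->; rewrite mul0r.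
rewrite schurLE schur_degree // big1 // => ka _.
by have [<-|_] := eqVneq la ka; rewrite ?(schur_degree K ne) ?mulr0 ?mul0r.
Qed.

Lemma schur_coef_deg f d (la : intpart) : deg_le f d -> (d < sumn la)%N ->
  schur_coef f la = 0.
Proof.
move=> fd lt; pose a (la : intpart) := if (sumn (la : intpart) <= d)%N then schur_coef f
  la else 0.
have -> : schur_coef f = a; last by rewrite /a leqNgt lt.
apply: schur_coef_uniq => m; have [md|dm] := leqP (mdeg m) d.
  rewrite {1}schur_coefP; apply: eq_big_seq => ka; rewrite mem_allp /a => kam.
  by rewrite (leq_trans kam).
rewrite fd // big1 // => ka _; rewrite /a; case: leqP => kad; last by rewrite mul0r.
by rewrite schur_degree ?mulr0 // gtn_eqF // (leq_ltn_trans kad).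
Qed.

Lemma schur_decomp f d : deg_le f d ->
  f = \sum_(la <- allp d) schur_coef f la *: schurL K la.
Proof.
move=> fd; apply: lambda_ext => mu; rewrite lam_sum schur_coefP.
rewrite -fsum_schur (fsum_allp (d := d)) // => la lt.
by rewrite (schur_coef_deg fd lt) mul0r.
Qed.

Lemma hallE F f d : deg_le f d ->
  hall F f = \sum_(la <- allp d) schur_coef F la * schur_coef f la.
Proof. by move=> fd; apply: fsum_allp => la /(schur_coef_deg fd) ->; rewrite mulr0. Qed.

Lemma hallL F a f g : hall F (a *: f + g) = a * hall F f + hall F g.
Proof.
have [d1 /deg_leW f1] := deg_le_exists f; have [d2 /deg_leW g2] := deg_le_exists g.
pose d := maxn d1 d2; have fd := f1 _ (leq_maxl d1 d2); have gd := g2 _ (leq_maxr d1 d2).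
have fgd : deg_le (a *: f + g) d by move=> m dm;
  rewrite ?lamD ?lamZ fd // gd // mulr0 addr0.
rewrite (hallE F fd) (hallE F gd) (hallE F fgd) mulr_sumr -big_split /=.
by apply: eq_bigr => la _; rewrite schur_coefL mulrDr mulrCA.
Qed.

Lemma hall0 F : hall F 0 = 0.
Proof. by have := hallL F (-1) 0 0; rewrite scaler0 addr0 mulN1r addNr. Qed.

Lemma hall_sum F (I : Type) (r : seq I) (P : pred I) (a : I -> K) (f : I -> Lambda K) :
  hall F (\sum_(i <- r | P i) a i *: f i) = \sum_(i <- r | P i) a i * hall F (f i).
Proof.
elim: r => [|i r IHr]; first by rewrite !big_nil hall0.
by rewrite !big_cons; case: (P i); rewrite // hallL IHr.
Qed.

Lemma hall_schur F (la : intpart) : hall F (schurL K la) = schur_coef F la.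
Proof.
rewrite (hallE F (d := sumn la)); last exact: triangular_deg triangular_schurL.
rewrite (bigD1_seq la) ?allp_uniq ?mem_allp //= schur_coef_schur eqxx mulr1.
by rewrite big1 ?addr0 // => mu; rewrite schur_coef_schur eq_sym => /negbTE ->;
  rewrite mulr0.
Qed.

(** * Coordinates in the basis g and the dual family G *)

Fact gcoef_exists f : exists e : intpart -> K,
  forall d, deg_le f d -> (forall la : intpart, (d < sumn la)%N -> e la = 0) /\
     f = \sum_(la <- allp d) e la *: gdual K la.
Proof.
have [d fd] := deg_le_exists f.
have [e [e0 eE]] := triangular_basis triangular_gdual fd.
(* [e] comes from the bound [d]; comparing expansions over a common larger bound [k] shows that it
   serves for every degree bound [n]. *)
exists e => n fn; have [e' [e'0 e'E]] := triangular_basis triangular_gdual fn.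
have ee' (la : intpart) : e la = e' la.
  pose k := maxn (maxn d n) (sumn la).
  have E1 : \sum_(la <- allp k) e la *: gdual K la = f.
    rewrite [RHS]eE; apply/esym/allp_widen; first by rewrite !leq_max leqnn.
    by move=> ka /e0 ->; rewrite scale0r.
  have E2 : \sum_(la <- allp k) e' la *: gdual K la = f.
    rewrite [RHS]e'E; apply/esym/allp_widen; first by rewrite !leq_max leqnn orbT.
    by move=> ka /e'0 ->; rewrite scale0r.
  apply/eqP; rewrite -subr_eq0; apply/eqP.
  apply: (@triangular_free (gdual K) k (fun la => e la - e' la)).
  - exact: triangular_gdual.
  - by under eq_bigr do rewrite scalerBl; rewrite sumrB E1 E2 subrr.
  - by rewrite leq_max leqnn orbT.
by split=> [la /e'0|]; rewrite ?ee' // e'E; apply: eq_bigr => la _; rewrite ee'.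
Qed.

Definition gcoef f : intpart -> K := sval (cid (gcoef_exists f)).

Lemma gcoef_deg f d (la : intpart) : deg_le f d -> (d < sumn la)%N -> gcoef f la = 0.
Proof. by move/(svalP (cid (gcoef_exists f))) => -[H _]; apply: H. Qed.

Lemma gcoefP f d : deg_le f d -> f = \sum_(la <- allp d) gcoef f la *: gdual K la.
Proof. by move/(svalP (cid (gcoef_exists f))) => -[_ H]; apply: H. Qed.

Lemma gcoef_uniq f d (e : intpart -> K) : deg_le f d ->
  f = \sum_(la <- allp d) e la *: gdual K la ->
    forall la : intpart, (sumn la <= d)%N -> gcoef f la = e la.
Proof.
move=> fd fE la lad; apply/eqP; rewrite -subr_eq0; apply/eqP.
apply: (@triangular_free (gdual K) d (fun la => gcoef f la - e la)) => //.
  exact: triangular_gdual.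
under eq_bigr do rewrite scalerBl.
by rewrite sumrB -(gcoefP fd) -fE subrr.
Qed.

Lemma deg_leL a f g d : deg_le f d -> deg_le g d -> deg_le (a *: f + g) d.
Proof. by move=> fd gd m dm; rewrite ?lamD ?lamZ fd // gd // mulr0 addr0. Qed.

Lemma gcoefL a f g la : gcoef (a *: f + g) la = a * gcoef f la + gcoef g la.
Proof.
have [d1 /deg_leW f1] := deg_le_exists f; have [d2 /deg_leW g2] := deg_le_exists g.
pose d := maxn (maxn d1 d2) (sumn la).
have fd : deg_le f d by apply: f1; rewrite !leq_max leqnn.
have gd : deg_le g d by apply: g2; rewrite !leq_max leqnn orbT.
apply: (@gcoef_uniq _ d (fun la => a * gcoef f la + gcoef g la)).
- exact: deg_leL.
- rewrite {1}(gcoefP fd) {1}(gcoefP gd) scaler_sumr -big_split; apply: eq_bigr => ka _ /=.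
  by rewrite scalerDl scalerA.
- by rewrite leq_max leqnn orbT.
Qed.

Lemma gcoef0 la : gcoef 0 la = 0.
Proof. by have := gcoefL (-1) 0 0 la; rewrite scaler0 addr0 mulN1r addNr. Qed.

Lemma gcoef_sum (I : Type) (r : seq I) (P : pred I) (a : I -> K) (f : I -> Lambda K) la :
  gcoef (\sum_(i <- r | P i) a i *: f i) la = \sum_(i <- r | P i) a i * gcoef (f i) la.
Proof.
elim: r => [|i r IHr]; first by rewrite !big_nil gcoef0.
by rewrite !big_cons; case: (P i); rewrite // gcoefL IHr.
Qed.

Lemma gcoef_gdual (la mu : intpart) : gcoef (gdual K la) mu = (la == mu)%:R.
Proof.
pose d := maxn (sumn la) (sumn mu).
apply: (@gcoef_uniq _ d (fun mu => (la == mu)%:R)); last by rewrite leq_max leqnn orbT.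
  apply: (@deg_leW _ (sumn la)); first exact: leq_maxl.
  exact: triangular_deg triangular_gdual.
rewrite (bigD1_seq la) ?allp_uniq ?mem_allp ?leq_maxl //= eqxx scale1r big1 ?addr0 // => ka.
by rewrite eq_sym => /negbTE ->; rewrite scale0r.
Qed.

Fact hat_of_coef_subproof (a : intpart -> K) :
  Series (fun m => \sum_(la <- allp (mdeg m)) a la * schur K la m) \in @Defs.is_sym K.
Proof.
apply/asboolP => s m m' bs mE /=; rewrite (permmon_mdeg bs mE).
by apply: eq_bigr => la _; congr (_ * _); have /asboolP := schur_sym K la; apply;
  [exact: bs|exact: mE].
Qed.
Definition hat_of_coef a : LambdaHat K := MkLambdaHat (hat_of_coef_subproof a).

(** The witness for the dual family is the transpose of the change of basis: its Schur coefficients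
    are the [g_la] coordinates of the Schur functions. Arbitrary coefficients are allowed in the
    completion. *)
Lemma Groth_gdual la mu : hall (Groth K la) (gdual K mu) = (la == mu)%:R.
Proof.
rewrite /Groth; case: xgetP => [F ->
  //|/(_ (hat_of_coef (fun ka => gcoef (schurL K ka) la)))].
case=> {}mu; set F := hat_of_coef _.
have FE : schur_coef F = fun ka => gcoef (schurL K ka) la by exact: schur_coef_uniq.
have gd : deg_le (gdual K mu) (sumn mu) by exact: triangular_deg triangular_gdual.
rewrite (hallE _ gd) FE eq_sym -gcoef_gdual {2}(schur_decomp gd) gcoef_sum.
by apply: eq_bigr => ka _; rewrite mulrC.
Qed.

Lemma hall_Groth (la : intpart) f : hall (Groth K la) f = gcoef f la.
Proof.
have [d0 /deg_leW fd0] := deg_le_exists f; pose d := maxn d0 (sumn la).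
have fd := fd0 _ (leq_maxl d0 (sumn la)).
rewrite {1}(gcoefP fd) hall_sum (bigD1_seq la) ?allp_uniq ?mem_allp ?leq_maxr //=.
rewrite Groth_gdual eqxx mulr1 big1 ?addr0 // => mu.
by rewrite Groth_gdual eq_sym => /negbTE ->; rewrite mulr0.
Qed.

End Bases.

(** * Substituting 1 for a variable *)

Definition mexp (m : monom) : seq nat := mkseq m (sval (cid (monom_bound m))).

Lemma mexpK m : mon (mexp m) = m.
Proof. by apply/esym/monom_mon; apply: (svalP (cid (monom_bound m))). Qed.

Lemma nth_mexp m i : nth 0%N (mexp m) i = m i.
Proof. by rewrite -{2}(mexpK m) monE. Qed.

Lemma mdeg_sumn (m : monom) : mdeg m = sumn (mexp m).
Proof. by rewrite -{1}(mexpK m) mdeg_mon. Qed.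

Lemma monP (m n : monom) : m =1 n -> m = n.
Proof. by move=> mn; apply/eqP/cmP. Qed.

Definition consm (k : nat) (m : monom) : monom := mon (k :: mexp m).
Definition tailm (m : monom) : monom := mon (behead (mexp m)).

Lemma consm0 k m : consm k m 0%N = k. Proof. by rewrite monE. Qed.
Lemma consmS k (m : monom) i : consm k m i.+1 = m i. Proof. by rewrite monE /= nth_mexp.
  Qed.
Lemma tailmE (m : monom) i : tailm m i = m i.+1. Proof. by rewrite monE nth_behead
  nth_mexp. Qed.

Lemma consm_tail (m : monom) : consm (m 0%N) (tailm m) = m.
Proof. by apply: monP => -[|i]; rewrite ?consm0 // consmS tailmE. Qed.

Lemma consm_inj k k' m m' : consm k m = consm k' m' -> k = k' /\ m = m'.
Proof.
move=> E; split; first by rewrite -(consm0 k m) E consm0.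
by apply: monP => i; rewrite -(consmS k m) E consmS.
Qed.

Lemma eq_consm k k' m m' : (consm k m == consm k' m') = (k == k') && (m == m').
Proof. by apply/eqP/andP => [/consm_inj[-> ->]//|[/eqP -> /eqP ->]]. Qed.

Lemma consmM i j (m n : monom) : mmul (consm i m) (consm j n) = consm (i + j) (mmul m n).
Proof. by apply: monP => -[|l]; rewrite cmM ?consm0 // !consmS cmM. Qed.

Lemma mdeg_consm k (m : monom) : mdeg (consm k m) = (k + mdeg m)%N.
Proof. by rewrite mdeg_mon /= mdeg_sumn. Qed.

Lemma consm_mon k s : consm k (mon s) = mon (k :: s).
Proof. by apply: monP => -[|i]; rewrite ?consm0 ?consmS !monE. Qed.

Section Substitution.
Variable K : comPzRingType.
Implicit Types (f g : Lambda K).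

(** The monomials that become [m] are the [consm k m], of degree at least [k]. Any [N] above the
    degree bound will do, which lets several functions share one range. *)
Lemma subst_sum f d N m : deg_le f d -> (d < N)%N ->
  subst_1x f m = \sum_(0 <= k < N) f (consm k m).
Proof.
move=> fd dN; pose r := [seq consm k m | k <- index_iota 0 N].
rewrite /subst_1x /= (fsbigE r).
- rewrite big_seq_cond (eq_bigl (fun n => n \in r)); last first.
    move=> n; apply/andb_idr => /mapP[k _ ->]; rewrite inE /= => i.
    by rewrite consmS.
  by rewrite -big_seq big_map.
- by rewrite map_inj_uniq ?iota_uniq // => i j /consm_inj[].
- by move=> _ /= /mapP[k _ ->] i; rewrite consmS.
- move=> n nm nr; apply: fd; apply: leq_trans dN _; rewrite leqNgt; apply: contra nr => lt.
  have nE : n = consm (n 0%N) m by apply: monP => -[|i]; rewrite ?consm0 // consmS nm.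
  rewrite nE; apply: map_f; rewrite mem_index_iota /=.
  by apply: leq_ltn_trans lt; rewrite nE mdeg_consm consm0 leq_addr.
Qed.

Lemma eval_1_sum f d N : deg_le f d -> (d < N)%N ->
  eval_1 f = \sum_(0 <= k < N) f (mon [:: k]).
Proof.
move=> fd dN; rewrite -(eq_bigr _ (fun k _ => congr1 _ (consm_mon k [::]))).
rewrite -(subst_sum _ fd dN); apply: eq_fsbigl; apply/seteqP.
by split=> n /= H i; rewrite H monE nth_nil.
Qed.

(** Evaluation is the constant term of the substitution and inherits its morphism properties from
    there. *)
Lemma eval_1_subst f : eval_1 f = subst_1x f (mon [::]).
Proof.
have [d fd] := deg_le_exists f;
  rewrite (eval_1_sum fd (ltnSn d)) (subst_sum _ fd (ltnSn d)).
by apply: eq_bigr => k _; rewrite consm_mon.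
Qed.

Lemma subst_sym f : subst_1x f \in @Defs.is_sym K.
Proof.
apply/asboolP/perm_sym_seriesP => s t st; have [d fd] := deg_le_exists f.
rewrite !(subst_sum _ fd (ltnSn d)); apply: eq_bigr => k _; rewrite !consm_mon.
by apply: sym_series_perm; [exact: hat_sym|rewrite perm_cons].
Qed.
Definition subst_hat f : LambdaHat K := MkLambdaHat (subst_sym f).

Lemma subst_bounded f : subst_hat f \in @is_bounded K.
Proof.
have [d fd] := deg_le_exists f; apply/asboolP; exists d => m dm.
change (subst_1x f m = 0); rewrite (subst_sum _ fd (ltnSn d)) big1 // => k _.
by rewrite fd // mdeg_consm (leq_trans dm) // leq_addl.
Qed.
Definition subst1 f : Lambda K := MkLambda (subst_bounded f).

Lemma subst1_sum f d N m : deg_le f d -> (d < N)%N ->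
  subst1 f m = \sum_(0 <= k < N) f (consm k m).
Proof. exact: subst_sum. Qed.

Lemma lambdaP f g : (forall m, f m = g m) -> f = g.
Proof. by move=> fg; apply: lambda_ext. Qed.

Lemma deg_le2 f g : exists d, deg_le f d /\ deg_le g d.
Proof.
have [d1 fd] := deg_le_exists f; have [d2 gd] := deg_le_exists g.
by exists (maxn d1 d2); split; [apply: deg_leW fd|apply: deg_leW gd];
  rewrite ?leq_maxl ?leq_maxr.
Qed.

Lemma subst1_is_linear : linear subst1.
Proof.
move=> a f g; apply: lambdaP => m; have [d [fd gd]] := deg_le2 f g.
rewrite lamD lamZ (subst1_sum _ fd (ltnSn d)) (subst1_sum _ gd (ltnSn d)).
rewrite (subst1_sum _ (deg_leL a fd gd) (ltnSn d)) mulr_sumr -big_split.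
by apply: eq_bigr => k _; rewrite lamD lamZ.
Qed.
HB.instance Definition _ := GRing.isLinear.Build K (Lambda K) (Lambda K) *:%R subst1
  subst1_is_linear.

Lemma lamM f g m : (f * g) m = smul f g m. Proof. by []. Qed.
Lemma lam1 m : (1 : Lambda K) m = (m == mone)%:R. Proof. by []. Qed.

Lemma mulr_consm f g M k m (s : seq monom) : uniq s ->
    (forall a b, mmul a b = m -> a \in s) -> (k < M)%N ->
  (f * g) (consm k m) = \sum_(0 <= i < M) \sum_(a <- s) \sum_(0 <= j < M) \sum_(b <- s)
    if (i + j == k)%N && (mmul a b == m) then f (consm i a) * g (consm j b) else 0.
Proof.
move=> us sP kM; rewrite lamM.
rewrite (@smulE K [seq consm i a | i <- index_iota 0 M, a <- s]).
- rewrite big_allpairs_dep /=; apply: eq_bigr => i _; apply: eq_bigr => a _.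
  rewrite big_allpairs_dep /=; apply: eq_bigr => j _; apply: eq_bigr => b _.
  by rewrite consmM eq_consm.
- by apply: allpairs_uniq; rewrite ?iota_uniq // => -[i a] [j b] _ _ /= /consm_inj[-> ->].
- move=> a b abk; rewrite -(consm_tail a); apply: allpairs_f.
    have := congr1 (fun n : monom => n 0%N) abk; rewrite cmM consm0 => E.
    by rewrite mem_index_iota /= (leq_ltn_trans _ kM) // -E leq_addr.
  apply: (sP _ (tailm b)); apply: monP => i; rewrite cmM !tailmE.
  by rewrite -(consmS k m) -abk cmM.
Qed.

Lemma subst1M f g : subst1 (f * g) = subst1 f * subst1 g.
Proof.
apply: lambdaP => m; have [d [fd gd]] := deg_le2 f g; have [e fge] := deg_le_exists (f * g).
(* [M] exceeds the bound [e] of the product, so that the sum over [k] is complete, and [d + d], so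
   that terms with [i + j] at least [M] vanish. *)
pose M := (maxn e (d + d)).+1.
have eM : (e < M)%N by rewrite ltnS leq_maxl.
have ddM : (d + d < M)%N by rewrite ltnS leq_maxr.
have dM : (d < M)%N by apply: leq_ltn_trans ddM; apply: leq_addr.
have [s us sP] := divisors_finite m.
rewrite (subst1_sum _ fge eM) lamM (smulE _ _ us sP).
under eq_big_nat => k /andP[_ kM] do rewrite (mulr_consm _ _ us sP kM).
rewrite exchange_big /=; under eq_bigr do rewrite exchange_big /=.
rewrite exchange_big /=; apply: eq_bigr => a _.
transitivity (\sum_(b <- s) \sum_(0 <= i < M) \sum_(0 <= j < M)
    if mmul a b == m then f (consm i a) * g (consm j b) else 0); last first.
  apply: eq_bigr => b _; case: eqP => _; last by rewrite big1 // => i _; rewrite big1.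
  rewrite -[RHS]/(subst1 f a * subst1 g b).
  rewrite (subst1_sum _ fd dM) (subst1_sum _ gd dM) mulr_suml; apply: eq_bigr => i _.
  by rewrite mulr_sumr.
rewrite [RHS]exchange_big; apply: eq_bigr => i _.
rewrite exchange_big [RHS]exchange_big /=; apply: eq_bigr => j _.
rewrite exchange_big; apply: eq_bigr => b _ /=.
case: eqP => _; last by rewrite big1 // => k _; rewrite andbF.
have [ijM|Mij] := ltnP (i + j)%N M.
  rewrite (bigD1_seq (i + j)%N) ?iota_uniq ?mem_index_iota //= eqxx big1 ?addr0 // => k.
  by rewrite eq_sym => /negbTE ->.
have -> : f (consm i a) * g (consm j b) = 0.
  have [di|id_] := ltnP d i;
    first by rewrite fd ?mul0r // mdeg_consm (leq_trans di) ?leq_addr.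
  have [dj|jd] := ltnP d j; first by rewrite gd ?mulr0 // mdeg_consm (leq_trans dj)
    ?leq_addr.
  by have := leq_trans ddM (leq_trans Mij (leq_add id_ jd)); rewrite ltnn.
by rewrite big1 // => k _; case: ifP.
Qed.

Lemma subst1_1 : subst1 1 = 1.
Proof.
apply: lambdaP => m; have [d d1] := deg_le_exists (1 : Lambda K).
have one0 : consm 0 mone = mone by apply: monP => -[|i]; rewrite ?consm0 ?consmS !cm1.
rewrite (subst1_sum _ d1 (ltnSn d)) big_ltn // !lam1 -{1}one0 eq_consm eqxx /=.
rewrite big_nat big1 ?addr0 // => k /andP[k0 _]; rewrite -one0 eq_consm.
by rewrite gtn_eqF.
Qed.

Lemma subst1_monoid_morphism : monoid_morphism subst1.
Proof. by split; [exact: subst1_1|exact: subst1M]. Qed.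

Lemma eval_1_is_zmod_morphism : zmod_morphism (@eval_1 K).
Proof.
move=> f g; rewrite !eval_1_subst.
change (subst1 (f - g) (mon [::]) = subst1 f (mon [::]) - subst1 g (mon [::])).
by rewrite raddfB lamB.
Qed.
Lemma eval_1_is_monoid_morphism : monoid_morphism (@eval_1 K).
Proof.
have one : mon [::] = mone by apply: monP => i; rewrite monE nth_nil cm1.
split=> [|f g]; rewrite !eval_1_subst.
  by change (subst1 1 (mon [::]) = 1); rewrite subst1_1 lam1 one eqxx.
change (subst1 (f * g) (mon [::]) = subst1 f (mon [::]) * subst1 g (mon [::])).
rewrite subst1M lamM (@smulE K [:: mone]) //.
  by rewrite !big_seq1 one mulm1 eqxx.
move=> a b; rewrite one inE => ab; rewrite -mdeg_eq0.
by have := congr1 mdeg ab; rewrite mdegM mdeg1 => /eqP; rewrite addn_eq0 => /andP[].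
Qed.
HB.instance Definition _ := GRing.isZmodMorphism.Build (Lambda K) K (@eval_1 K)
  eval_1_is_zmod_morphism.
HB.instance Definition _ := GRing.isMonoidMorphism.Build (Lambda K) K (@eval_1 K)
  eval_1_is_monoid_morphism.

Lemma eval_1Z a f : eval_1 (a *: f) = a * eval_1 f.
Proof.
rewrite !eval_1_subst.
change (subst1 (a *: f) (mon [::]) = a * subst1 f (mon [::])).
by rewrite linearZ lamZ.
Qed.

Lemma eval_1_lin (I : Type) (r : seq I) (P : pred I) (a : I -> K) (f : I -> Lambda K) :
  eval_1 (\sum_(i <- r | P i) a i *: f i) = \sum_(i <- r | P i) a i * eval_1 (f i).
Proof. by rewrite raddf_sum; apply: eq_bigr => i _; exact: eval_1Z. Qed.

(** The bound is strict, so that [d = 0] means [f = 0] and starts the inductions. *)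
Definition deg_lt f d := forall m : monom, (d <= mdeg m)%N -> f m = 0.

(** The term [k = 0] is [f m], since symmetry moves a zero exponent to the end; the terms with
    positive [k] are coefficients of [f] in higher degree. *)
Lemma subst1_unipotent f d : deg_lt f d.+1 -> deg_lt (subst1 f - f) d.
Proof.
move=> fd m dm; rewrite lamB (subst1_sum m (d := d) (N := d.+1)) // big_ltn //.
have -> : f (consm 0 m) = f m.
  rewrite -{2}(mexpK m) -[mexp m]cats0.
  have -> : mon (mexp m ++ [::]) = mon (mexp m ++ [:: 0%N]).
    apply/mon_eq => i; rewrite monE cats0 nth_cat; case: ltnP => // mi.
    by rewrite nth_default //; case: (_ - _)%N => // -[].
  by apply: sym_series_perm; [exact: hat_sym|rewrite perm_sym perm_catC].
rewrite big_nat big1 ?addr0 ?subrr // => k /andP[k0 _].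
by apply: fd; rewrite mdeg_consm -add1n leq_add.
Qed.

Lemma subst1_bij : bijective subst1.
Proof.
have lt_ex f : exists d, deg_lt f d by have [d fd] := deg_le_exists f; exists d.+1.
have inj0 d f : deg_lt f d -> subst1 f = 0 -> f = 0.
  elim: d f => [|d IHd] f fd f0; first by apply: lambdaP => m; rewrite fd.
  apply: IHd => // m dm; have := subst1_unipotent fd dm.
  by rewrite f0 lamB => /eqP; rewrite sub0r oppr_eq0 => /eqP.
have surj d f : deg_lt f d -> exists g, subst1 g = f.
  elim: d f => [|d IHd] f fd.
    by exists 0; rewrite linear0; apply: lambdaP => m; rewrite fd.
  have [g gE] := IHd _ (subst1_unipotent fd).
  (* As [g] is a preimage of [subst1 f - f], the image of [f - g] is [f]. *)
  by exists (f - g); rewrite linearB /= gE opprB addrC subrK.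
have inj : injective subst1.
  move=> f g fg; apply/eqP; rewrite -subr_eq0; apply/eqP.
  by have [d] := lt_ex (f - g); move/inj0; apply; rewrite linearB /= fg subrr.
have ex f : exists g, subst1 g = f by have [d /surj] := lt_ex f.
exists (fun f => sval (cid (ex f))) => f; last exact: (svalP (cid (ex f))).
by apply: inj; apply: (svalP (cid (ex _))).
Qed.

End Substitution.

(** * Slices, the coproduct and the adjoint operators *)

Section Slices.
Variable K : comPzRingType.
Implicit Types (f g : Lambda K) (F : LambdaHat K).

(** Lists for the same monomial may differ by trailing zeros, which matter once [t] is appended;
    symmetry moves [t] to the front, where they are harmless. *)
Lemma sym_cat (f : series K) s s' t : sym_series f -> nth 0%N s =1 nth 0%N s' ->
  f (mon (s ++ t)) = f (mon (s' ++ t)).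
Proof.
move=> fs ss'; have catC (u v : seq nat) : perm_eq (u ++ v) (v ++ u) by rewrite perm_catC.
rewrite (sym_series_perm fs (catC s t)) (sym_series_perm fs (catC s' t)).
by congr (f _); apply: mon_eq => i; rewrite monE !nth_cat; case: ltnP.
Qed.

Lemma sym_catl (f : series K) s t t' : sym_series f -> nth 0%N t =1 nth 0%N t' ->
  f (mon (s ++ t)) = f (mon (s ++ t')).
Proof.
move=> fs tt'; congr (f _); apply: mon_eq => i; rewrite monE !nth_cat.
by case: ltnP.
Qed.

(* The coefficient of y^b in f(x, y). *)
Fact slice_subproof f b : Series (fun a => f (mon (mexp b ++ mexp a))) \in @Defs.is_sym K.
Proof.
have fs := hat_sym f; apply/asboolP/perm_sym_seriesP => s t st /=.
rewrite (sym_catl _ fs (t' := s)); last by move=> i; rewrite nth_mexp monE.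
rewrite (sym_catl (t := mexp (mon t)) _ fs (t' := t)); last by move=> i;
  rewrite nth_mexp monE.
by apply: sym_series_perm; rewrite // perm_cat2l.
Qed.
Definition slice_hat f b : LambdaHat K := MkLambdaHat (slice_subproof f b).

Lemma slice_hat_deg f b d : deg_le f d -> forall m : monom, (d < mdeg m)%N ->
  slice_hat f b m = 0.
Proof.
by move=> fd m dm; apply: fd;
  rewrite mdeg_mon sumn_cat -mdeg_sumn (leq_trans dm) // -mdeg_sumn leq_addl.
Qed.

Fact slice_bounded f b : slice_hat f b \in @is_bounded K.
Proof.
by have [d fd] := deg_le_exists f; apply/asboolP; exists d; apply: slice_hat_deg.
Qed.
Definition slice f b : Lambda K := MkLambda (slice_bounded f b).

Lemma slice_deg f b d : deg_le f d -> deg_le (slice f b) d.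
Proof. exact: slice_hat_deg. Qed.

Lemma slice_deg0 f b d : deg_le f d -> (d < mdeg b)%N -> slice f b = 0.
Proof.
move=> fd db; apply: lambdaP => m; apply: fd.
by rewrite mdeg_mon sumn_cat -mdeg_sumn (leq_trans db) // leq_addr.
Qed.

Lemma slice_mon f s t : slice f (mon t) (mon s) = f (mon (t ++ s)).
Proof.
have fs := hat_sym f; rewrite -[LHS]/(f (mon (mexp (mon t) ++ mexp (mon s)))).
rewrite (sym_catl _ fs (t' := s)); last by move=> i; rewrite nth_mexp monE.
by apply: sym_cat => // i; rewrite nth_mexp monE.
Qed.

Lemma count_interleave (p : pred nat) (m : nat -> nat) N :
  (count p (mkseq m N.*2) =
   count p (mkseq (fun i => m i.*2) N) + count p (mkseq (fun i => m i.*2.+1) N))%N.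
Proof.
elim: N => // N IHN; rewrite /mkseq doubleS -[N.*2.+2]addn2 -[in X in _ = X]addn1.
rewrite !iotaD !map_cat !count_cat -!/(mkseq _ _) IHN /= !add0n !addn0.
by rewrite addnACA.
Qed.

(** By symmetry the interleaved exponents of the two alphabets may be placed in two consecutive
    blocks, which is how a slice reads [f]. *)
Lemma slice_interleave f (a b m : monom) : (forall i, m i.*2 = a i) ->
  (forall i, m i.*2.+1 = b i) -> f m = slice f b a.
Proof.
move=> ma mb; have [N mN] := monom_bound m.
have m2N i : (N.*2 <= i)%N -> m i = 0%N.
  by move=> Ni; apply: mN; apply: leq_trans Ni; rewrite -addnn leq_addr.
have aN : a = mon (mkseq a N).
  apply: monom_mon => i Ni; rewrite -ma; apply: mN; apply: leq_trans Ni _.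
  by rewrite -addnn leq_addr.
have bN : b = mon (mkseq b N).
  apply: monom_mon => i Ni; rewrite -mb; apply: mN; apply: leq_trans Ni _.
  by rewrite -addnn leqW // leq_addr.
rewrite {1}aN {1}bN slice_mon (monom_mon m2N).
apply: sym_series_perm; first exact: hat_sym.
apply/permP => p; rewrite count_interleave count_cat addnC.
by congr (_ + _)%N; congr (count _ _); apply: eq_map => i; rewrite ?ma ?mb.
Qed.

Lemma interleave_exists (a b : monom) : exists m : monom,
  (forall i, m i.*2 = a i) /\ (forall i, m i.*2.+1 = b i).
Proof.
have [N1 aN] := monom_bound a; have [N2 bN] := monom_bound b.
pose N := maxn N1 N2; pose u i := if odd i then b i./2 else a i./2.
exists (mon (mkseq u N.*2)); split=> i; rewrite monE.
  have [lt|ge] := ltnP i.*2 N.*2.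
    by rewrite nth_mkseq // /u odd_double doubleK.
  rewrite nth_default ?size_mkseq // aN //; move: ge.
  by rewrite leq_double geq_max => /andP[].
have [lt|ge] := ltnP i.*2.+1 N.*2.
  by rewrite nth_mkseq // /u /= odd_double /= uphalf_double.
rewrite nth_default ?size_mkseq // bN //; move: ge.
by rewrite leq_Sdouble geq_max => /andP[].
Qed.

Lemma schur_slice_sym f la : Series (fun b => schur_coef (slice f b) la) \in @Defs.is_sym K.
Proof.
have fs := hat_sym f; apply/asboolP/perm_sym_seriesP => s t st.
rewrite -[LHS]/(schur_coef (slice f (mon s)) la).
suff -> : slice f (mon s) = slice f (mon t) by [].
apply: lambdaP => m; rewrite -(mexpK m) !slice_mon.
by apply: sym_series_perm => //; rewrite perm_cat2r.
Qed.
Definition schur_slice_hat f la : LambdaHat K := MkLambdaHat (schur_slice_sym f la).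

Lemma schur_slice_bounded f la : schur_slice_hat f la \in @is_bounded K.
Proof.
have [d fd] := deg_le_exists f; apply/asboolP; exists d => b db.
rewrite -[LHS]/(schur_coef (slice f b) la) (slice_deg0 fd db).
have := schur_coefL (-1) 0 (0 : LambdaHat K) la.
by rewrite scaler0 addr0 mulN1r addNr.
Qed.
(** The image of [f] under the adjoint of multiplication by [s_la]: the factor facing [s_la] in the
    coproduct. *)
Definition schur_slice f la : Lambda K := MkLambda (schur_slice_bounded f la).

Lemma coproduct_exists f : exists t, is_coproduct f t.
Proof.
have [d fd] := deg_le_exists f.
exists [seq (schurL K la, schur_slice f la) | la <- allp d] => a b m ma mb.
rewrite (slice_interleave f ma mb) {1}(schur_decomp (slice_deg b fd)) lam_sum big_map.
by apply: eq_bigr => la _; rewrite lamZ mulrC.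
Qed.

(** Any decomposition of the coproduct writes the slice as a combination of its first factors, so by
    linearity the result does not depend on the one chosen. *)
Lemma perpE F f b : perp F f b = hall F (slice f b).
Proof.
have cop : is_coproduct f (coproduct f).
  by rewrite /coproduct; case: xgetP => // nE; have [t /nE] := coproduct_exists f.
have -> : slice f b = \sum_(p <- coproduct f) p.2 b *: p.1.
  apply: lambdaP => a; have [m [ma mb]] := interleave_exists a b.
  rewrite -(slice_interleave f ma mb) (cop a b m ma mb) lam_sum.
  by apply: eq_bigr => p _; rewrite lamZ mulrC.
rewrite hall_sum /perp lam_sum; apply: eq_bigr => p _.
by rewrite lamZ mulrC.
Qed.

(** * One-row Schur functions and the pairing with H(1) *)

Lemma sumn_rowp k : sumn (rowp k) = k.
Proof.
rewrite (@sumn_rows (rowp k) (maxn 1 (size (rowp k)))) ?leq_maxr // big_ltn ?leq_max //.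
rewrite row_len_rowp big_nat big1 ?addn0 // => -[|i] //.
by rewrite row_len_rowp.
Qed.

Lemma schur_rowp_mon la k : schur K la (mon [:: k]) = (la == rowp k)%:R.
Proof.
rewrite (schur_content K _ (monE _)) nchain1 ?psub0 // cdiff0 /= addn0.
case: (eqVneq la (rowp k)) => [->|ne].
  by rewrite row_len_rowp sumn_rowp !eqxx.
case: eqP => // kE; case: eqP => // rE; case/eqP: ne.
apply/esym/psub_eq; last by rewrite sumn_rowp.
by apply/psubP => -[|i]; rewrite row_len_rowp ?rE.
Qed.

Lemma eval_1_schur_coef f d N : deg_le f d -> (d < N)%N ->
  eval_1 f = \sum_(0 <= k < N) schur_coef f (rowp k).
Proof.
move=> fd dN; rewrite (eval_1_sum fd dN); apply: eq_bigr => k _.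
rewrite schur_coefP mdeg_mon -[sumn _]/(k + 0)%N addn0 (bigD1_seq (rowp k)) ?allp_uniq
  ?mem_allp ?sumn_rowp //.
rewrite schur_rowp_mon eqxx mulr1 big1 => [|la /negbTE ne]; first exact: addr0.
by rewrite schur_rowp_mon ne mulr0.
Qed.

Lemma schur_rowp i m : schur K (rowp i) m = (mdeg m == i)%:R.
Proof.
rewrite -(mexpK m) (schur_content K _ (monE _)) mdeg_mon sumn_rowp.
case: eqP => // E; rewrite (_ : emptyp = rowp 0) ?nchain_rowp ?E ?eqxx //.
by apply: intpart_ext => j; rewrite row_len_rowp row_emptyp; case: j.
Qed.

Lemma schur_coef_hsym i la : schur_coef (hsym_hat K i) la = (la == rowp i)%:R.
Proof.
suff -> : schur_coef (hsym_hat K i) = fun la => (la == rowp i)%:R by [].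
apply: schur_coef_uniq => m; rewrite -[LHS]/((mdeg m == i)%:R) -schur_rowp.
have [E|ne] := eqVneq (mdeg m) i.
  rewrite (bigD1_seq (rowp i)) ?allp_uniq ?mem_allp ?sumn_rowp ?E //.
  rewrite eqxx mul1r big1 => [|ka /negbTE ->]; first exact/esym/addr0.
  by rewrite mul0r.
rewrite schur_rowp (negbTE ne) big1 // => ka _.
by case: eqP => [->|_]; rewrite ?schur_rowp ?(negbTE ne) ?mulr0 ?mul0r.
Qed.

Lemma Hgen1E m : Hgen (1 : K) m = 1.
Proof.
rewrite /Hgen /= (fsbigE [:: mdeg m]) //.
  by rewrite big_cons big_nil in_setT expr1n mul1r eqxx; apply: addr0.
move=> i _; rewrite inE => /negbTE ne.
by rewrite eq_sym ne mulr0.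
Qed.

(** [la == rowp (sumn la)] says that [la] has at most one row. *)
Lemma schur_coef_Hgen1 la : schur_coef (Hgen (1 : K)) la = (la == rowp (sumn la))%:R.
Proof.
suff -> : schur_coef (Hgen (1 : K)) = fun la => (la == rowp (sumn la))%:R by [].
apply: schur_coef_uniq => m; rewrite Hgen1E.
rewrite (bigD1_seq (rowp (mdeg m))) ?allp_uniq ?mem_allp ?sumn_rowp //.
rewrite eqxx mul1r schur_rowp eqxx big1 => [|ka ne]; first exact/esym/addr0.
case: eqP => [kE|_]; last by rewrite mul0r.
rewrite schur_degree ?mulr0 //; apply: contraNneq ne => E; rewrite E.
by apply/eqP.
Qed.

Lemma hall_hsym i f : hall (hsym_hat K i) f = schur_coef f (rowp i).
Proof.
have [d0 /deg_leW fd0] := deg_le_exists f; pose d := maxn d0 i.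
rewrite (hallE _ (fd0 d (leq_maxl _ _))) (bigD1_seq (rowp i)) ?allp_uniq ?mem_allp
  ?sumn_rowp ?leq_maxr //.
rewrite schur_coef_hsym eqxx mul1r big1 => [|la /negbTE ne]; first exact: addr0.
by rewrite schur_coef_hsym ne mul0r.
Qed.

Lemma eval_1_schurL la : eval_1 (schurL K la) = (la == rowp (sumn la))%:R.
Proof.
have sd : deg_le (schurL K la) (sumn la) by apply: triangular_deg; apply: triangular_schurL.
rewrite (eval_1_schur_coef sd (ltnSn _)) big_nat_recr //= schur_coef_schur.
rewrite big_nat big1 ?add0r // => k /andP[_ lt]; rewrite schur_coef_schur.
by case: eqP => // E; rewrite E sumn_rowp ltnn in lt.
Qed.

(** By linearity Schur functions suffice: only those of one-row shapes contain a power of [x_1], and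
    these are the shapes occurring in H(1). *)
Lemma hall_Hgen1 f : hall (Hgen 1) f = eval_1 f.
Proof.
have [d fd] := deg_le_exists f.
rewrite (hallE _ fd) {2}(schur_decomp fd) eval_1_lin.
by apply: eq_bigr => la _; rewrite eval_1_schurL schur_coef_Hgen1 mulrC.
Qed.

Lemma eval_1_gskew la mu : psub mu la -> eval_1 (gskew K la mu) = 1.
Proof.
move=> ml; have gd : deg_le (gskew K la mu) (sumn la) by move=> m; apply: gskew_degree.
rewrite (eval_1_sum gd (ltnSn _)).
under eq_bigr do rewrite gskew_mon // nchain1 //.
have cd : (cdiff mu la < (sumn la).+1)%N.
  by rewrite ltnS; apply: leq_trans (sumn_cdiff ml); apply: leq_addl.
rewrite (bigD1_seq (cdiff mu la)) ?iota_uniq ?mem_index_iota //= eqxx big1 ?addr0 // => k.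
by rewrite eq_sym => /negbTE ->.
Qed.

Lemma eval_1_gcoef f d : deg_le f d -> eval_1 f = \sum_(la <- allp d) gcoef f la.
Proof.
move=> fd; rewrite {1}(gcoefP fd) eval_1_lin.
by apply: eq_bigr => la _; rewrite eval_1_gskew ?psub0 // mulr1.
Qed.

Lemma schur_coef_Groth la mu : schur_coef (Groth K la) mu = gcoef (schurL K mu) la.
Proof. by rewrite -hall_schur hall_Groth. Qed.

Lemma GrothE la m : Groth K la m =
  \sum_(ka <- allp (mdeg m)) gcoef (schurL K ka) la * schur K ka m.
Proof. by rewrite schur_coefP; apply: eq_bigr => ka _; rewrite schur_coef_Groth. Qed.

Lemma schurL_deg ka : deg_le (schurL K ka) (sumn (ka : intpart)).
Proof. by apply: triangular_deg; apply: triangular_schurL. Qed.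

(** A Schur function of degree below [sumn la] has no [g_la] coordinate. This is what makes the sum
    of all [G_la] meaningful. *)
Lemma Groth_degree (la : intpart) (m : monom) : (mdeg m < sumn la)%N -> Groth K la m = 0.
Proof.
move=> lt; rewrite GrothE big1_seq // => ka; rewrite mem_allp => /andP[_ kam].
by rewrite (gcoef_deg (schurL_deg (ka := ka))) ?mul0r // (leq_ltn_trans kam).
Qed.

(** The coefficient of [s_ka] in the sum of the [G_la] is the sum of the g coordinates of [s_ka].
    Each [g_la] evaluates to 1, so this is the value of [s_ka] at (1, 0, ...), that is, its pairing
    with H(1). *)
Lemma Hgen1_Groth : Hgen (1 : K) = hatsum (Groth K).
Proof.
apply: val_inj; apply: seriesP => m;
  rewrite -[RHS]/(\sum_(la \in [set: intpart]) Groth K la m).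
rewrite (fsum_allp (d := mdeg m)); last by move=> la; apply: Groth_degree.
under eq_bigr do rewrite GrothE.
rewrite exchange_big -[LHS]/(Hgen 1 m) schur_coefP; apply: eq_big_seq => ka;
  rewrite mem_allp => kam.
rewrite -mulr_suml; congr (_ * _).
by rewrite -hall_schur hall_Hgen1 (eval_1_gcoef (d := mdeg m)) // => n;
  apply: deg_leW (schurL_deg (ka := ka)) _.
Qed.

Lemma summable_Groth : summable (Groth K).
Proof.
move=> m; apply: (sub_finite_set (B := [set` allp (mdeg m)])); last exact: finite_seq.
move=> la /= nz; rewrite mem_allp leqNgt; apply/negP => /Groth_degree E.
by rewrite E eqxx in nz.
Qed.

Lemma summable_hsym : summable (hsym_hat K).
Proof.
move=> m; apply: (sub_finite_set (B := [set mdeg m])); last exact: finite_set1.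
by move=> i /=; have [-> //|_] := eqVneq (mdeg m) i; rewrite eqxx.
Qed.

Lemma Hgen1_hsym : Hgen (1 : K) = hatsum (hsym_hat K).
Proof.
apply: val_inj; apply: seriesP => m; apply: eq_fsbigr => i _ /=.
by rewrite expr1n mul1r.
Qed.

(** Evaluating the slice at [b] puts the exponent of the variable set to 1 after those of [b], the
    substitution puts it before; symmetry identifies the two. *)
Lemma subst1_perp f : subst1 f = perp (Hgen 1) f.
Proof.
apply: lambdaP => b; rewrite perpE hall_Hgen1; have [d fd] := deg_le_exists f.
rewrite (eval_1_sum (slice_deg b fd) (ltnSn d)) (subst1_sum _ fd (ltnSn d)).
apply: eq_bigr => k _; rewrite -{1}(mexpK b) -{2}(mexpK b) slice_mon consm_mon.
by apply: sym_series_perm; [exact: hat_sym|rewrite perm_sym perm_catC].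
Qed.

(** * The substitution as a pointwise finite sum of adjoint operators *)

Lemma opsum_seq (J : choiceType) (r : seq J) (A : J -> Lambda K -> Lambda K) f :
  uniq r -> (forall j, j \notin r -> A j f = 0) ->
  finite_set [set j | A j f != 0] /\ \sum_(j \in [set: J]) A j f = \sum_(j <- r) A j f.
Proof.
move=> ur A0; split.
  apply: (sub_finite_set (B := [set` r])); last exact: finite_seq.
  by move=> j /=; apply: contraNT => /A0 ->.
rewrite (fsbigE r) //; last by move=> j _; apply: A0.
by apply: eq_bigl => j; rewrite in_setT.
Qed.

Lemma opsum_Groth : is_opsum (fun la => perp (Groth K la)) (@subst1 K).
Proof.
move=> f; have [d fd] := deg_le_exists f.
have [|la|fin ->] := @opsum_seq _ (allp d) (fun la => perp (Groth K la)) f;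
  first exact: allp_uniq.
  (* The bound [d] on [f] bounds all its slices, so the same finitely many [la] serve for every
     [b]. *)
  rewrite mem_allp -ltnNge => lt; apply: lambdaP => b.
  by rewrite perpE hall_Groth (gcoef_deg (slice_deg b fd)).
split=> //; rewrite subst1_perp; apply: lambdaP => b.
rewrite perpE hall_Hgen1 lam_sum (eval_1_gcoef (slice_deg b fd)).
by apply: eq_bigr => la _; rewrite perpE hall_Groth.
Qed.

Lemma opsum_hsym : is_opsum (fun i => perp (hsym_hat K i)) (@subst1 K).
Proof.
move=> f; have [d fd] := deg_le_exists f.
have [|i|fin ->] := @opsum_seq _ (index_iota 0 d.+1) (fun i => perp (hsym_hat K i)) f.
- exact: iota_uniq.
- rewrite mem_index_iota -leqNgt => di; apply: lambdaP => b.
  by rewrite perpE hall_hsym (schur_coef_deg (slice_deg b fd)) ?sumn_rowp.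
split=> //; rewrite subst1_perp; apply: lambdaP => b.
rewrite perpE hall_Hgen1 lam_sum (eval_1_schur_coef (slice_deg b fd) (ltnSn d)).
by apply: eq_bigr => i _; rewrite perpE hall_hsym.
Qed.

(** * Images of the skew functions under the substitution *)

Lemma subst1_gskew_l la mu : psub mu la ->
  subst1 (gskew K la mu) = \sum_(nu <- between mu la) gskew K la nu.
Proof.
move=> ml; have gd : deg_le (gskew K la mu) (sumn la) by move=> m; apply: gskew_degree.
apply: lambda_ext => s; rewrite (subst1_sum _ gd (ltnSn _)) lam_sum.
transitivity (\sum_(0 <= k < (sumn la).+1) \sum_(nu <- between mu la)
    if cdiff mu nu == k then (nchain nu la s)%:R else 0 : K).
  apply: eq_bigr => k _; rewrite consm_mon gskew_mon //= natr_sum.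
  by rewrite big_mkcond.
rewrite exchange_big; apply: eq_big_seq => nu; rewrite mem_between => /andP[mn nl].
have cd : (cdiff mu nu < (sumn la).+1)%N.
  rewrite ltnS; apply: leq_trans (sumn_psub nl); apply: leq_trans (sumn_cdiff mn).
  exact: leq_addl.
rewrite (bigD1_seq (cdiff mu nu)) ?iota_uniq ?mem_index_iota //= eqxx big1 ?addr0
  ?gskew_mon // => k.
by rewrite eq_sym => /negbTE ->.
Qed.

(** By symmetry the variable set to 1 may be the last letter, so the last link of the chain is
    removed and [mu] stays fixed. *)
Lemma subst1_gskew_r la mu : psub mu la ->
  subst1 (gskew K la mu) = \sum_(nu <- between mu la) gskew K nu mu.
Proof.
move=> ml; have gd : deg_le (gskew K la mu) (sumn la) by move=> m; apply: gskew_degree.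
apply: lambda_ext => s; rewrite (subst1_sum _ gd (ltnSn _)) lam_sum.
transitivity (\sum_(0 <= k < (sumn la).+1) \sum_(nu <- between mu la)
    if cdiff nu la == k then (nchain mu nu s)%:R else 0 : K).
  apply: eq_bigr => k _; rewrite consm_mon gskew_mon //.
  rewrite -(nchain_perm _ _ (_ : perm_eq (rcons s k) (k :: s))) ?perm_rcons //.
  by rewrite nchain_rcons natr_sum big_mkcond.
rewrite exchange_big; apply: eq_big_seq => nu; rewrite mem_between => /andP[mn nl].
have cd : (cdiff nu la < (sumn la).+1)%N.
  by rewrite ltnS; apply: leq_trans (sumn_cdiff nl); apply: leq_addl.
rewrite (bigD1_seq (cdiff nu la)) ?iota_uniq ?mem_index_iota //= eqxx big1 ?addr0
  ?gskew_mon // => k.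
by rewrite eq_sym => /negbTE ->.
Qed.

Lemma fsum_between (H : intpart -> Lambda K) mu la :
  \sum_(nu \in [set nu | part_sub mu nu /\ part_sub nu la]) H nu = \sum_(nu <- between mu
    la) H nu.
Proof.
rewrite [RHS]fsbig_seq ?uniq_between //; apply: eq_fsbigl; apply/seteqP; split=> nu /=.
  by move=> [/psubP mn /psubP nl]; rewrite mem_between mn.
by rewrite mem_between => /andP[/psubP mn /psubP nl].
Qed.

Lemma fsum_below (H : intpart -> Lambda K) la :
  \sum_(nu \in [set nu | part_sub nu la]) H nu = \sum_(nu <- between emptyp la) H nu.
Proof.
rewrite -fsum_between; apply: eq_fsbigl; apply/seteqP; split=> nu /=; last by case.
by move=> ?; split=> //; apply/psubP/psub0.
Qed.

End Slices.

Theorem theorem4p7 (K : comPzRingType) :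
  ([/\ summable (hsym_hat K), summable (Groth K),
       Hgen (1 : K) = hatsum (hsym_hat K) &
       Hgen (1 : K) = hatsum (Groth K)]) /\
  (exists i : {rmorphism Lambda K -> K},
     [/\ forall f : Lambda K, i f = eval_1 f,
         forall f : Lambda K, i f = hall (Hgen 1) f &
         forall la mu : intpart, part_sub mu la -> i (gskew K la mu) = 1]) /\
  (exists I : {linear Lambda K -> Lambda K},
     (* I is the K-linear map defined by its values on the g_la *)
     ((forall la : intpart,
         I (gdual K la) = \sum_(mu \in [set mu | part_sub mu la]) gdual K mu) /\
      (forall J : {linear Lambda K -> Lambda K},
         (forall la : intpart,
            J (gdual K la) = \sum_(mu \in [set mu | part_sub mu la]) gdual K mu) ->
         J =1 I)) /\
     (* I is a ring automorphism *)
     (monoid_morphism I /\ bijective I) /\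
     [/\ forall f : Lambda K, I f = perp (Hgen 1) f,
         is_opsum (fun la : intpart => perp (Groth K la)) I,
         is_opsum (fun i : nat => perp (hsym_hat K i)) I &
         forall f : Lambda K, (I f : series K) = subst_1x f] /\
     (forall la mu : intpart, part_sub mu la ->
        I (gskew K la mu) =
          \sum_(nu \in [set nu | part_sub mu nu /\ part_sub nu la]) gskew K nu mu /\
        I (gskew K la mu) =
          \sum_(nu \in [set nu | part_sub mu nu /\ part_sub nu la]) gskew K la nu) /\
     (forall la : intpart,
        I (gdual K la) = \sum_(nu \in [set nu | part_sub nu la]) gdual K nu /\
        I (gdual K la) = \sum_(nu \in [set nu | part_sub nu la]) gskew K la nu)).
Proof.
split; [|split].
- by split; [exact: summable_hsym|exact: summable_Groth|exact: Hgen1_hsym|exact: Hgen1_Groth].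
- exists (@eval_1 K : {rmorphism Lambda K -> K}); split=> [//|f|la mu /psubP ml].
    by rewrite hall_Hgen1.
  exact: eval_1_gskew.
exists (@subst1 K : {linear Lambda K -> Lambda K}).
have Ig (la : intpart) : subst1 (gdual K la) = \sum_(mu \in [set mu | part_sub mu la]) gdual K mu.
  by rewrite fsum_below; apply: subst1_gskew_r; apply: psub0.
split; [split=> // J JE f|split; [|split; [|split]]].
- have [d fd] := deg_le_exists f; rewrite (gcoefP fd) !linear_sum; apply: eq_bigr => la _.
  by rewrite !linearZ /= JE Ig.
- by split; [exact: subst1_monoid_morphism|exact: subst1_bij].
- by split=> // f; [exact: subst1_perp|exact: opsum_Groth|exact: opsum_hsym].
- move=> la mu /psubP ml; rewrite !fsum_between.
  by split; [exact: subst1_gskew_r|exact: subst1_gskew_l].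
move=> la; split; first exact: Ig.
by rewrite fsum_below; apply: subst1_gskew_l; apply: psub0.
Qed.
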